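(* There is an explicit pseudorandom generator that $\varepsilon$-fools the class of read-$\Delta$ $\mathbb{F}_2$-polynomials on $n$ variables with seed length $\mathrm{poly}(\Delta,\log n,\log(1/\varepsilon))$.
   Context: An $\mathbb{F}_2$-polynomial (sum of distinct multilinear monomials, of any degree) is read-$\Delta$ if each variable appears in at most $\Delta$ of its monomials. A function $G\colon\{0,1\}^s\to\{0,1\}^n$ $\varepsilon$-fools a class $\mathcal{F}$ of functions $\{0,1\}^n\to\{0,1\}$ if $|\Pr_{z\sim\{0,1\}^s}[f(G(z))=1]-\Pr_{x\sim\{0,1\}^n}[f(x)=1]|\le\varepsilon$ for every $f\in\mathcal{F}$; $s$ is the seed length. Explicit means $G$ is computable in time polynomial in $n$ (and the seed length). *)

(* Defs.v *)
From HB Require Import structures.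
From mathcomp Require Export all_boot all_order all_algebra.
From mathcomp Require Export reals exp.

Set Implicit Arguments.
Unset Strict Implicit.
Unset Printing Implicit Defensive.

Export Order.TTheory GRing.Theory Num.Theory.

Local Open Scope ring_scope.

Notation bits n := (n.-tuple bool).

(* A multilinear monomial is the set of its variables (set0 is the monomial 1);
   a polynomial is the set of the monomials having coefficient 1. *)
Definition f2poly (n : nat) := {set {set 'I_n}}.

Definition f2eval (n : nat) (p : f2poly n) (x : bits n) : 'F_2 :=
  \sum_(m in p) \prod_(i in m) (tnth x i)%:R.

Definition read (n : nat) (D : nat) (p : f2poly n) : Prop :=
  forall i : 'I_n, (#|[set m in p | i \in m]| <= D)%N.

Definition read_f2polys (n D : nat) (f : bits n -> bool) : Prop :=
  exists2 p : f2poly n, read D p & forall x, f x = (f2eval p x == 1).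

Definition prob (R : realType) (s : nat) (A : pred (bits s)) : R :=
  #|A|%:R / 2 ^+ s.

Definition fools (R : realType) (s n : nat) (e : R) (G : bits s -> bits n)
    (F : (bits n -> bool) -> Prop) : Prop :=
  forall f, F f -> `|prob R (fun z => f (G z)) - prob R (fun x => f x)| <= e.

(* Random access machine with addition and truncated subtraction at unit cost:
   numbers in t steps grow by a factor of at most 2 ^ t, so polynomial time is
   the same as on a Turing machine (Cook and Reckhow).  There is no unit-cost
   multiplication.  A program names finitely many registers; memory is
   addressed through the contents of registers. *)
Inductive ram : Type :=
| Const of nat & nat
| Add of nat & nat & nat
| Sub of nat & nat & nat
| Fetch of nat & nat
| Store of nat & nat
| Seq of ram & ram
| If of nat & ram & ram
| While of nat & ram.

Record state := State { reg : nat -> nat; cell : nat -> nat }.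

Definition upd (f : nat -> nat) (a v : nat) : nat -> nat :=
  fun b => if b == a then v else f b.

Definition set_reg (st : state) (r v : nat) : state :=
  State (upd (reg st) r v) (cell st).

Definition set_cell (st : state) (a v : nat) : state :=
  State (reg st) (upd (cell st) a v).

(* [exec c st t st']: c started in st halts in st' after exactly t steps. *)
Inductive exec : ram -> state -> nat -> state -> Prop :=
| exec_const r v st : exec (Const r v) st 1 (set_reg st r v)
| exec_add r a b st :
    exec (Add r a b) st 1 (set_reg st r (reg st a + reg st b)%N)
| exec_sub r a b st :
    exec (Sub r a b) st 1 (set_reg st r (reg st a - reg st b)%N)
| exec_fetch r a st :
    exec (Fetch r a) st 1 (set_reg st r (cell st (reg st a)))
| exec_store a r st :
    exec (Store a r) st 1 (set_cell st (reg st a) (reg st r))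
| exec_seq c1 c2 st1 t1 st2 t2 st3 :
    exec c1 st1 t1 st2 -> exec c2 st2 t2 st3 ->
    exec (Seq c1 c2) st1 (t1 + t2)%N st3
| exec_if_true r c1 c2 st t st' :
    reg st r != 0%N -> exec c1 st t st' -> exec (If r c1 c2) st t.+1 st'
| exec_if_false r c1 c2 st t st' :
    reg st r = 0%N -> exec c2 st t st' -> exec (If r c1 c2) st t.+1 st'
| exec_while_done r c st :
    reg st r = 0%N -> exec (While r c) st 1 st
| exec_while_step r c st1 t1 st2 t2 st3 :
    reg st1 r != 0%N -> exec c st1 t1 st2 -> exec (While r c) st2 t2 st3 ->
    exec (While r c) st1 (t1 + t2).+1 st3.

(* Parameters and the seed length in registers 0, 1, 2, 3; the seed in memory
   cells 0, 1, ..., s - 1; everything else is zero. *)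
Definition input (n D k s : nat) (z : bits s) : state :=
  State (nth 0%N [:: n; D; k; s]) (fun i => nat_of_bool (nth false z i)).

Definition log2 (R : realType) (x : R) : R := ln x / ln 2.

(* The number of bits of precision, through which the real error parameter is
   passed to the machine. *)
Definition precision (R : realType) (e : R) : nat :=
  `|Num.ceil (log2 e^-1)|%N.

Definition explicit (R : realType) (s : nat -> nat -> R -> nat)
    (G : forall n D (e : R), bits (s n D e) -> bits n) : Prop :=
  exists (c : ram) (C : nat), forall (n D : nat) (e : R) (z : bits (s n D e)),
    (0 < n)%N -> 0 < e < 1 ->
    exists (t : nat) (st : state),
      [/\ exec c (input n D (precision e) z) t st,
          (t <= C * (n + s n D e) ^ C)%N
        & forall i : 'I_n, cell st i = tnth (G n D e z) i].

(* Main.v *)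
Require Import Defs.
From mathcomp Require Import ring lra zify.

Set Implicit Arguments.
Unset Strict Implicit.
Unset Printing Implicit Defensive.

(* Write [f = (-1)^p].  One round overwrites the uniform input on a random set V by
   a bounded-independence string; after enough rounds every variable has been
   overwritten and no uniform bit is left.  Since read-D polynomials are closed under
   restriction, it suffices that one round changes the mean of f by little.

   Monomials of degree above d vanish under any d-wise independent distribution
   except with probability 2^-d each, so assume that the degree is at most d.  Write
   V as S /\ T, where S has density 1/polylog and T has density 1/2.  Two variables
   are adjacent when they share a monomial; degrees are at most D d, so the graph
   induced on S is subcritical and its components have at most l variables.  Whatever
   the variables outside S are, f is then a product of signs g_c over disjoint blocks
   of at most l variables of S.

   For such a product the round is analysed as by Forbes and Kelley, with blocks in
   place of Fourier characters: average g_c over the fresh variables, write the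
   result as mu_c + h_c, and expand the product.  Terms with few factors h_c are
   integrated exactly by bounded independence.  The others are grouped by their k-th
   factor h_c, and Cauchy-Schwarz bounds a group by 2^(-k/2), because averaging over
   a random half of the variables halves the variance of g_c.

   A bounded-independence bit i is the parity of the seed bits (q, i mod q), q <= B.
   The central binomial coefficient of 2m = B divides lcm(1..2m), so it divides a
   product of differences |i - i'| if no q <= B separates i from all i'; this bounds
   the number of i', and a separating q gives a seed bit which only i reads. *)

Local Open Scope ring_scope.

(** * Means over finite types *)

Section Mean.
Variable R : realType.
Implicit Types T : finType.

Definition mean T (f : T -> R) : R := (\sum_x f x) / #|T|%:R.

Lemma eq_mean T (f g : T -> R) : f =1 g -> mean f = mean g.
Proof. by move=> fg; rewrite /mean (eq_bigr g). Qed.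

Lemma meanD T (f g : T -> R) : mean (fun x => f x + g x) = mean f + mean g.
Proof. by rewrite /mean big_split mulrDl. Qed.

Lemma meanZ T a (f : T -> R) : mean (fun x => a * f x) = a * mean f.
Proof. by rewrite /mean -mulr_sumr mulrA. Qed.

Lemma meanZr T a (f : T -> R) : mean (fun x => f x * a) = mean f * a.
Proof. by rewrite mulrC -meanZ; apply: eq_mean => x; rewrite mulrC. Qed.

Lemma meanB T (f g : T -> R) : mean (fun x => f x - g x) = mean f - mean g.
Proof. by rewrite /mean big_split sumrN mulrDl mulNr. Qed.

Lemma mean_sum T I (r : seq I) (P : pred I) (f : I -> T -> R) :
  mean (fun x => \sum_(i <- r | P i) f i x) = \sum_(i <- r | P i) mean (f i).
Proof. by rewrite /mean exchange_big /= mulr_suml. Qed.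

Lemma mean_cst T a : (0 < #|T|)%N -> mean (fun _ : T => a) = a.
Proof.
move=> T0; rewrite /mean sumr_const -(mulr_natr a) mulfK //.
by rewrite pnatr_eq0 -lt0n.
Qed.

Lemma mean0 T : mean (fun _ : T => 0) = 0.
Proof. by rewrite /mean big1 // mul0r. Qed.

Lemma ler_mean T (f g : T -> R) : (forall x, f x <= g x) -> mean f <= mean g.
Proof. by move=> fg; rewrite /mean ler_wpM2r ?invr_ge0 // ler_sum. Qed.

Lemma mean_ge0 T (f : T -> R) : (forall x, 0 <= f x) -> 0 <= mean f.
Proof. by move=> f0; rewrite -(mean0 T); apply: ler_mean. Qed.

Lemma mean_norm T (f : T -> R) : `|mean f| <= mean (fun x => `|f x|).
Proof.
rewrite ler_norml -[- _]mulN1r -meanZ; apply/andP; split; apply: ler_mean => x.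
  by rewrite mulN1r lerNl ler_normr lexx orbT.
exact: ler_norm.
Qed.

Lemma mean_exchange T T' (f : T -> T' -> R) :
  mean (fun x => mean (f x)) = mean (fun y => mean (fun x => f x y)).
Proof.
rewrite /mean -!mulr_suml -!mulrA [X in _ * X]mulrC; congr (_ * _).
exact: exchange_big.
Qed.

Lemma mean_pair T T' (f : T * T' -> R) :
  mean f = mean (fun x => mean (fun y => f (x, y))).
Proof.
rewrite /mean -mulr_suml card_prod natrM invfM pair_big /=.
rewrite -mulrA [X in _ * X]mulrC; congr (_ * _).
by apply: eq_bigr => -[].
Qed.

Lemma mean_reindex T T' (h : T -> T') (f : T' -> R) :
  bijective h -> mean f = mean (fun x => f (h x)).
Proof.
move=> hb; rewrite /mean (bij_eq_card hb); congr (_ / _).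
by rewrite (reindex h) //; apply: onW_bij.
Qed.

(* The typical mx takes some coordinates from x and the others from y. *)
Lemma mean_swap T (mx : T -> T -> T) (f : T -> R) :
  (forall x y, mx (mx x y) (mx y x) = x) ->
  mean f = mean (fun x => mean (fun y => f (mx x y))).
Proof.
move=> mxK.
have [T0|T0] := posnP #|T|; first by rewrite /mean T0 invr0 !mulr0.
have -> : mean f = mean (fun x => mean (fun _ : T => f x)).
  by apply: eq_mean => x; rewrite mean_cst.
rewrite -(mean_pair (fun p => f p.1)) -(mean_pair (fun p => f (mx p.1 p.2))).
rewrite (@mean_reindex _ _ (fun p : T * T => (mx p.1 p.2, mx p.2 p.1))) //.
by exists (fun p : T * T => (mx p.1 p.2, mx p.2 p.1)) => -[x y] /=;
  rewrite !mxK.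
Qed.

(** Substituting [mx x y] for the input, with x and y independent, makes f a function of x alone and
    g a function of y alone. *)
Lemma mean_prod_indep T (mx : T -> T -> T) (f g : T -> R) :
  (forall x y, mx (mx x y) (mx y x) = x) ->
  (forall x y, f (mx x y) = f x) -> (forall x y, g (mx x y) = g y) ->
  mean (fun x => f x * g x) = mean f * mean g.
Proof.
move=> mxK fx gy; rewrite (mean_swap _ mxK) -meanZr; apply: eq_mean => x.
by rewrite -meanZ; apply: eq_mean => y; rewrite fx gy.
Qed.

(** Cauchy-Schwarz without square roots, from [2 a |f| <= a ^ 2 + f ^ 2]. *)
Lemma ler_mean_norm_sqr T (f : T -> R) (a : R) : 0 < a ->
  mean (fun x => f x ^+ 2) <= a ^+ 2 -> (0 < #|T|)%N ->
  mean (fun x => `|f x|) <= a.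
Proof.
move=> a0 fa T0; rewrite -(ler_pM2l (_ : 0 < 2 * a)); last by lra.
rewrite -meanZ.
apply: le_trans (_ : mean (fun x => a ^+ 2 + f x ^+ 2) <= _).
  apply: ler_mean => x; rewrite -[f x ^+ 2]real_normK ?num_real //.
  have := sqr_ge0 (a - `|f x|); nra.
by rewrite meanD mean_cst //; nra.
Qed.

End Mean.

(** * Mixing strings of bits *)

Section Strings.
Variable n : nat.

Definition bstr := {ffun 'I_n -> bool}.
Implicit Types (x y S : bstr).

Definition mix S x y : bstr := [ffun i => if S i then x i else y i].

Lemma mixK S x y : mix S (mix S x y) (mix S y x) = x.
Proof. by apply/ffunP => i; rewrite !ffunE; case: (S i). Qed.

Lemma card_bstr : #|{: bstr}| = (2 ^ n)%N.
Proof. by rewrite card_ffun card_bool card_ord. Qed.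

Lemma card_bstr_gt0 : (0 < #|{: bstr}|)%N.
Proof. by rewrite card_bstr expn_gt0. Qed.

Definition strc S : bstr := [ffun i => ~~ S i].

Lemma strcK : involutive strc.
Proof. by move=> x; apply/ffunP => i; rewrite !ffunE negbK. Qed.

Definition depends (T : Type) (J : {set 'I_n}) (f : bstr -> T) :=
  forall x y, {in J, x =1 y} -> f x = f y.

End Strings.
Arguments mix {n}.

(** * Averaging over a random half of the variables *)

Section Contraction.
Variables (R : realType) (n : nat).
Notation X := (bstr n).
Implicit Types (x y u T : X) (g : X -> R).

(** For [p = (x, T)] this is the conditional expectation of g given the coordinates of x in T. In a
    round, x will be the overwriting string and T the set of density 1/2. *)
Definition noisy g (p : X * X) : R := mean (fun u : X => g (mix p.2 p.1 u)).

Lemma mean_mix (S : X) g : mean (fun x => mean (fun y => g (mix S x y))) = mean g.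
Proof. by rewrite -(mean_swap g (mixK S)). Qed.

Lemma mean_noisy g : mean (noisy g) = mean g.
Proof.
rewrite mean_pair mean_exchange -[RHS](mean_cst _ (card_bstr_gt0 n)).
by apply: eq_mean => T; apply: mean_mix.
Qed.

(** For fixed T, [noisy] is an orthogonal projection. *)
Lemma mean_mul_noisy g T :
  mean (fun x => g x * noisy g (x, T)) = mean (fun x => noisy g (x, T) ^+ 2).
Proof.
rewrite -[LHS](mean_mix T); apply: eq_mean => x /=.
have e y : noisy g (mix T x y, T) = noisy g (x, T).
  apply: eq_mean => u /=; congr g; apply/ffunP => i; rewrite !ffunE.
  by case: (T i).
rewrite expr2 {2}/noisy -meanZr /=; apply: eq_mean => y.
by rewrite e.
Qed.

(** The projections for T and for its complement are orthogonal, because g has mean 0 and they read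
    independent coordinates. This is Bessel's inequality, obtained by expanding the square of the
    remainder. *)
Lemma noisy_split g T : mean g = 0 ->
  mean (fun x => noisy g (x, T) ^+ 2) + mean (fun x => noisy g (x, strc T) ^+ 2)
  <= mean (fun x => g x ^+ 2).
Proof.
move=> g0.
have sq : 0 <= mean (fun x => (g x - noisy g (x, T) - noisy g (x, strc T)) ^+ 2).
  by apply: mean_ge0 => x; exact: sqr_ge0.
have cross : mean (fun x => noisy g (x, T) * noisy g (x, strc T)) = 0.
  rewrite (mean_prod_indep (mixK T)).
  - by rewrite [X in X * _](mean_mix T) g0 mul0r.
  - move=> x y; apply: eq_mean => u /=; congr g; apply/ffunP => i.
    by rewrite !ffunE; case: (T i).
  - move=> x y; apply: eq_mean => u /=; congr g; apply/ffunP => i.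
    by rewrite !ffunE; case: (T i).
suff : mean (fun x => (g x - noisy g (x, T) - noisy g (x, strc T)) ^+ 2) =
  mean (fun x => g x ^+ 2) - mean (fun x => noisy g (x, T) ^+ 2)
  - mean (fun x => noisy g (x, strc T) ^+ 2) by lra.
have -> : mean (fun x => (g x - noisy g (x, T) - noisy g (x, strc T)) ^+ 2) =
  mean (fun x => g x ^+ 2 + noisy g (x, T) ^+ 2 + noisy g (x, strc T) ^+ 2
   + (-2) * (g x * noisy g (x, T)) + (-2) * (g x * noisy g (x, strc T))
   + 2 * (noisy g (x, T) * noisy g (x, strc T))).
  by apply: eq_mean => x; ring.
by rewrite !meanD !meanZ cross !mean_mul_noisy; ring.
Qed.

(** A sign with mean mu has variance [1 - mu ^ 2]. A uniform T and its complement are equally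
    distributed, and by [noisy_split] the two variances sum to at most the variance of g, so the
    average over T is at most half of it. *)
Lemma noisy_contraction g : (forall x, g x ^+ 2 = 1) ->
  mean (fun p => (noisy g p - mean g) ^+ 2) <= (1 - mean g ^+ 2) / 2.
Proof.
move=> g1; set mu := mean g; pose h x := g x - mu.
have X0 := card_bstr_gt0 n.
have h0 : mean h = 0 by rewrite meanB mean_cst // subrr.
have h2 : mean (fun x => h x ^+ 2) = 1 - mu ^+ 2.
  have -> : mean (fun x => h x ^+ 2) =
            mean (fun x => 1 + mu ^+ 2 + (- 2 * mu) * g x).
    apply: eq_mean => x; have := g1 x.
    by rewrite /h => e; ring: e.
  by rewrite meanD mean_cst // meanZ -/mu; ring.
have nh p : noisy g p - mu = noisy h p.
  by rewrite /noisy meanB mean_cst.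
rewrite (eq_mean (g := fun p => noisy h p ^+ 2)); last by move=> p; rewrite nh.
rewrite mean_pair mean_exchange.
set F := fun T => mean (fun x => noisy h (x, T) ^+ 2).
have FC : mean F = mean (fun T => F (strc T)).
  by apply: mean_reindex; exists (@strc n); apply: strcK.
rewrite ler_pdivlMr //.
have -> : mean F * 2 = mean (fun T => F T + F (strc T)).
  by rewrite meanD -FC; ring.
rewrite -h2 -[leRHS](mean_cst _ X0); apply: ler_mean => T.
exact: noisy_split.
Qed.

End Contraction.

(** * Products of functions of disjoint blocks *)

Section LowDegree.
Variables (R : realType) (n : nat).
Notation W := (bstr n * bstr n)%type.
Implicit Types (f g : W -> R) (J : {set 'I_n}).

Definition pair_depends J f :=
  forall v w : W, {in J, v.1 =1 w.1} -> {in J, v.2 =1 w.2} -> f v = f w.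

(** Sums of juntas replace polynomials of degree at most d: they are what d-wise independence
    integrates exactly, and degrees add under products. *)
Inductive low_degree (d : nat) : (W -> R) -> Prop :=
| low_degree_junta J f : (#|J| <= d)%N -> pair_depends J f -> low_degree d f
| low_degree_add f g h : low_degree d f -> low_degree d g ->
    (forall w, h w = f w + g w) -> low_degree d h.

Lemma low_degree_mul d d' f g h : low_degree d f -> low_degree d' g ->
  (forall w, h w = f w * g w) -> low_degree (d + d') h.
Proof.
move=> lf; elim: lf h => {f} [J f Jd fJ|f1 f2 f _ IH1 _ IH2 fE] h lg hE.
- elim: lg h hE => {g} [J' g Jd' gJ|g1 g2 g _ IH1 _ IH2 gE] h hE.
    apply: (@low_degree_junta _ (J :|: J')).
      by apply: leq_trans (leq_card_setU _ _) _; apply: leq_add.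
    move=> v w e1 e2; rewrite !hE; congr (_ * _).
      by apply: fJ => i iJ; [apply: e1|apply: e2]; rewrite inE iJ.
    by apply: gJ => i iJ; [apply: e1|apply: e2]; rewrite inE iJ orbT.
  apply: low_degree_add (IH1 _ (fun=> erefl)) (IH2 _ (fun=> erefl)) _ => w.
  by rewrite hE gE mulrDr.
- apply: low_degree_add (IH1 _ lg (fun=> erefl)) (IH2 _ lg (fun=> erefl)) _ => w.
  by rewrite hE fE mulrDl.
Qed.

Lemma low_degreeS d d' f : (d <= d')%N -> low_degree d f -> low_degree d' f.
Proof.
move=> dd; elim=> {f} [J f Jd fJ|f g h _ IHf _ IHg hE].
  by apply: low_degree_junta fJ; apply: leq_trans dd.
exact: low_degree_add hE.
Qed.

Lemma low_degree_eq d f g : f =1 g -> low_degree d f -> low_degree d g.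
Proof.
move=> fg lf; apply: (low_degree_add lf (g := fun=> 0)).
  by apply: (@low_degree_junta _ set0); rewrite ?cards0 // => v w.
by move=> w; rewrite fg addr0.
Qed.

Lemma low_degree_cst d a : low_degree d (fun=> a).
Proof. by apply: (@low_degree_junta _ set0); rewrite ?cards0 // => v w. Qed.

Lemma low_degree_sum d k (f : nat -> W -> R) :
  (forall j, (j < k)%N -> low_degree d (f j)) ->
  low_degree d (fun w => \sum_(j < k) f j w).
Proof.
elim: k => [|k IH] lf.
  by apply: low_degree_eq (low_degree_cst d 0) => w; rewrite big_ord0.
apply: low_degree_add (IH _) (lf k (ltnSn k)) _.
  by move=> j jk; apply: lf; exact: ltnW.
by move=> w; rewrite big_ord_recr.
Qed.

(** Both strings are read at the same indices J, so up to [2 d] bits may be involved. *)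
Definition dwise (Omega : finType) d (Y : Omega -> W) :=
  forall J f, (#|J| <= d)%N -> pair_depends J f ->
    mean (fun o => f (Y o)) = mean f.

Lemma dwise_low_degree (Omega : finType) d (Y : Omega -> W) f :
  dwise d Y -> low_degree d f -> mean (fun o => f (Y o)) = mean f.
Proof.
move=> hY; elim=> {f} [J f|f g h _ IHf _ IHg hE]; first exact: hY.
rewrite (eq_mean (g := fun o => f (Y o) + g (Y o))); last by move=> o; exact: hE.
by rewrite meanD IHf IHg -meanD; apply: eq_mean => w; rewrite hE.
Qed.

Definition indicator (J : {set 'I_n}) : bstr n := [ffun i => i \in J].

Lemma mean_mul_disjoint J J' f g : [disjoint J & J'] ->
  pair_depends J f -> pair_depends J' g ->
  mean (fun w => f w * g w) = mean f * mean g.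
Proof.
move=> dJ fJ gJ.
pose mx (v w : W) : W :=
  (mix (indicator J) v.1 w.1, mix (indicator J) v.2 w.2).
apply: (@mean_prod_indep _ _ mx).
- by move=> [x y] [x' y']; rewrite /mx /= !mixK.
- by move=> v w; apply: fJ => i iJ /=; rewrite !ffunE iJ.
- move=> v w; apply: gJ => i iJ /=; rewrite !ffunE ifN //;
  by rewrite (disjointFl dJ).
Qed.

Section Product.
Variables (l k : nat) (g : nat -> W -> R) (B : nat -> {set 'I_n}) (mu : nat -> R).
Hypothesis g_le1 : forall c w, `|g c w| <= 1.
Hypothesis g_dep : forall c, pair_depends (B c) (g c).
Hypothesis B_le : forall c, (#|B c| <= l)%N.
Hypothesis B_disj : forall c c', c != c' -> [disjoint B c & B c'].
Hypothesis g_mean : forall c, mean (g c) = mu c.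
Hypothesis g_var : forall c,
  mean (fun w => (g c w - mu c) ^+ 2) <= (1 - mu c ^+ 2) / 2.

Let h c w := g c w - mu c.

(* [part c j] collects the terms with exactly j factors h in the expansion of
   the product of mu c' + h c', c' < c. *)
Fixpoint part c j w : R :=
  if c is c'.+1 then
    mu c' * part c' j w + (if j is j'.+1 then h c' w * part c' j' w else 0)
  else (j == 0%N)%:R.

Let before c := \bigcup_(c' < c) B c'.

Let before_S c : before c.+1 = before c :|: B c.
Proof. by rewrite /before big_ord_recr. Qed.

Let before_disj c : [disjoint before c & B c].
Proof.
rewrite disjoint_sym; apply/bigcup_disjointP => c' _; apply: B_disj.
by rewrite neq_ltn ltn_ord orbT.
Qed.

Let h_dep c : pair_depends (B c) (h c).
Proof. by move=> v w e1 e2; rewrite /h (g_dep e1 e2). Qed.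

Let mean_h c : mean (h c) = 0.
Proof.
rewrite meanB g_mean mean_cst ?subrr //.
by rewrite card_prod muln_gt0 card_bstr_gt0.
Qed.

Lemma part_depends c j : pair_depends (before c) (part c j).
Proof.
elim: c j => [|c IH] j v w; first by [].
rewrite before_S => e1 e2 /=.
have IH' j' : part c j' v = part c j' w.
  by apply: IH => i ib; [apply: e1|apply: e2]; rewrite inE ib.
have hE : h c v = h c w.
  by apply: h_dep => i ib; [apply: e1|apply: e2]; rewrite inE ib orbT.
by case: j => [|j]; rewrite !IH' ?hE.
Qed.

(** Each of the j factors h reads one block of at most l variables; the factors mu are constants. *)
Lemma part_low_degree c j : low_degree (j * l) (part c j).
Proof.
elim: c j => [|c IH] j; first exact: low_degree_cst.
have l1 : low_degree (j * l) (fun w => mu c * part c j w).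
  rewrite -[(j * l)%N]add0n.
  exact: low_degree_mul (low_degree_cst 0 (mu c)) (IH j) (fun=> erefl).
case: j l1 => [|j] l1.
  by apply: low_degree_eq l1 => w /=; rewrite addr0.
apply: low_degree_add l1 _ (fun=> erefl).
rewrite mulSn; apply: low_degree_mul (IH j) (fun=> erefl).
exact: low_degree_junta (B_le c) (@h_dep c).
Qed.

Lemma mean_h_part c j : mean (fun w => h c w * part c j w) = 0.
Proof.
rewrite (mean_mul_disjoint _ (@h_dep c) (@part_depends c j)) ?mean_h ?mul0r //.
by rewrite disjoint_sym.
Qed.

(** A term with at least one factor h has mean 0: the last such factor is centred and independent of
    the earlier ones. *)
Lemma mean_part c j : mean (part c j) = if j == 0%N then \prod_(c' < c) mu c' else 0.
Proof.
elim: c j => [|c IH] j.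
  rewrite big_ord0 mean_cst; first by case: j.
  by rewrite card_prod muln_gt0 card_bstr_gt0.
rewrite [LHS]meanD meanZ IH; case: j => [|j] /=.
  by rewrite mean0 addr0 big_ord_recr /= mulrC.
by rewrite mulr0 add0r mean_h_part.
Qed.

(** In the square of the recursion for [part] the cross term vanishes, as h is centred and
    independent of what precedes. With [m = mu c ^ 2] and the bound [(1 - m) / 2] on the variance,
    the induction closes exactly: [m * 2^-(j+1) + (1 - m) / 2 * 2^-j = 2^-(j+1)]. *)
Lemma mean_part_sqr c j : mean (fun w => part c j w ^+ 2) <= (2^-1) ^+ j.
Proof.
elim: c j => [|c IH] j.
  rewrite /= mean_cst; last by rewrite card_prod muln_gt0 card_bstr_gt0.
  case: j => [|j] /=; first by rewrite expr1n expr0.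
  by rewrite expr0n exprn_ge0 // invr_ge0.
have mu1 : mu c ^+ 2 <= 1.
  have := le_trans (mean_ge0 (fun w => sqr_ge0 (h c w))) (g_var c); lra.
case: j => [|j] /=.
  rewrite (eq_mean (g := fun w => mu c ^+ 2 * part c 0 w ^+ 2)); last first.
    by move=> w; rewrite addr0 exprMn.
  rewrite meanZ expr0; have := IH 0%N; rewrite expr0.
  have := mean_ge0 (fun w => sqr_ge0 (part c 0 w)); have := sqr_ge0 (mu c).
  by nra.
rewrite (eq_mean (g := fun w => mu c ^+ 2 * part c j.+1 w ^+ 2
  + 2 * mu c * (h c w * (part c j w * part c j.+1 w))
  + h c w ^+ 2 * part c j w ^+ 2)); last by move=> w; ring.
have dis : [disjoint B c & before c] by rewrite disjoint_sym.
rewrite !meanD !meanZ.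
rewrite (mean_mul_disjoint dis (@h_dep c)); last first.
  by move=> v w e1 e2; rewrite !(part_depends _ e1 e2).
rewrite mean_h mul0r mulr0 addr0.
rewrite (mean_mul_disjoint dis (f := fun w => h c w ^+ 2)
  (g := fun w => part c j w ^+ 2)); first last.
- by move=> v w e1 e2; rewrite !(part_depends _ e1 e2).
- by move=> v w e1 e2; rewrite !(h_dep e1 e2).
have := IH j; have := IH j.+1; rewrite exprS.
have := g_var c; rewrite -/(h c).
set a := mean _; set b := mean _; set a' := mean _.
have a0 : 0 <= a by apply: mean_ge0 => w; apply: sqr_ge0.
have b0 : 0 <= b by apply: mean_ge0 => w; apply: sqr_ge0.
have a'0 : 0 <= a' by apply: mean_ge0 => w; apply: sqr_ge0.
have := sqr_ge0 (mu c).
set m := mu c ^+ 2 in mu1 *; set e := 2^-1 ^+ j.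
have e0 : 0 <= e by apply: exprn_ge0; lra.
move=> m0 am be ae.
have H1 : m * b <= m * (2^-1 * e) by apply: ler_wpM2l.
have H2 : a * a' <= (1 - m) / 2 * e by apply: ler_pM.
lra.
Qed.

(** The omitted terms have more than k factors h. Group them by the block c' of factor number
    [k + 1]: the earlier factors form [part c' k], and the later ones recombine into a product of
    values of g, which is at most 1. *)
Lemma product_expansion c w :
  `|\prod_(c' < c) g c' w - \sum_(j < k.+1) part c j w|
    <= \sum_(c' < c) `|h c' w * part c' k w|.
Proof.
elim: c => [|c IH].
  rewrite !big_ord0 big_ord_recl /= big1; last by move=> i _.
  by rewrite addr0 subrr normr0.
rewrite [leRHS]big_ord_recr /= [\prod_(c' < c.+1) _]big_ord_recr /=.
have -> : \prod_(i < c) g i w * g c w - \sum_(j < k.+1) part c.+1 j w =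
  (\prod_(i < c) g i w - \sum_(j < k.+1) part c j w) * g c w + h c w * part c k w.
  have -> : \sum_(j < k.+1) part c.+1 j w =
     mu c * (\sum_(j < k.+1) part c j w) + h c w * \sum_(j < k) part c j w.
    rewrite /= big_split /= -mulr_sumr; congr (_ + _).
    by rewrite big_ord_recl add0r mulr_sumr.
  by rewrite big_ord_recr /= /h; ring.
apply: le_trans (ler_normD _ _) _; rewrite lerD2r normrM.
apply: le_trans IH; rewrite -[leRHS]mulr1.
by apply: ler_wpM2l.
Qed.

End Product.

Lemma dwise_fools_product (Omega : finType) (Y : Omega -> W) (l k d C : nat)
    (g : nat -> W -> R) (B : nat -> {set 'I_n}) :
  (0 < #|Omega|)%N -> dwise d Y -> (2 * (k.*2.+1 * l) <= d)%N ->
  (forall c w, `|g c w| <= 1) -> (forall c, pair_depends (B c) (g c)) ->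
  (forall c, #|B c| <= l)%N -> (forall c c', c != c' -> [disjoint B c & B c']) ->
  (forall c, mean (fun w => (g c w - mean (g c)) ^+ 2)
              <= (1 - mean (g c) ^+ 2) / 2) ->
  `|mean (fun o => \prod_(c < C) g c (Y o)) - \prod_(c < C) mean (g c)|
    <= C%:R * (2^-1) ^+ k.
Proof.
move=> O0 hY dl g1 gB Bl Bd gv.
pose mu c := mean (g c); pose P := part g mu.
have lowP c j : (j < k.*2.+1)%N -> low_degree d (P c j).
  move=> jk; apply: low_degreeS (part_low_degree mu gB Bl c j).
  by apply: leq_trans dl; nia.
have mP : mean (fun o => \sum_(j < k.*2.+1) P C j (Y o)) = \prod_(c < C) mu c.
  rewrite (dwise_low_degree hY (low_degree_sum (lowP C))).
  rewrite mean_sum big_ord_recl (mean_part gB Bd (fun=> erefl)) /=.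
  rewrite [X in _ + X]big1 ?addr0 // => j _.
  by rewrite (mean_part gB Bd (fun=> erefl)).
rewrite -mP -meanB; apply: le_trans (mean_norm _) _.
apply: le_trans (_ : mean (fun o => \sum_(c < C)
   `|(g c (Y o) - mu c) * P c k.*2 (Y o)|) <= _).
  by apply: ler_mean => o; apply: product_expansion.
rewrite mean_sum; apply: le_trans (_ : \sum_(c < C) (2^-1) ^+ k <= _); last first.
  by rewrite sumr_const card_ord mulr_natl.
(* Cauchy-Schwarz halves the exponent, hence the truncation at [k.*2]; squaring doubles the degree,
   hence the factor 2 in the hypothesis on d. *)
apply: ler_sum => c _; apply: ler_mean_norm_sqr => //; first by rewrite exprn_gt0 ?invr_gt0.
pose f c w := (g c w - mu c) * P c k.*2 w.
have lf : low_degree (k.*2.+1 * l) (f c).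
  rewrite mulSn; apply: low_degree_mul (part_low_degree mu gB Bl c k.*2) (fun=> erefl).
  apply: low_degree_junta (Bl c) _ => v w e1 e2.
  by rewrite (gB _ _ _ e1 e2).
rewrite (dwise_low_degree hY (f := fun w => f c w ^+ 2)); last first.
  apply: low_degreeS dl _; rewrite mul2n -addnn.
  exact: (low_degree_mul lf lf (fun=> erefl)).
have dis : [disjoint B c & \bigcup_(c' < c) B c'].
  apply/bigcup_disjointP => c' _; apply: Bd.
  by rewrite neq_ltn ltn_ord orbT.
rewrite (eq_mean (g := fun w => (g c w - mu c) ^+ 2 * P c k.*2 w ^+ 2));
  last by move=> w; rewrite exprMn.
rewrite (mean_mul_disjoint dis (f := fun w => (g c w - mu c) ^+ 2)
  (g := fun w => P c k.*2 w ^+ 2)); first last.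
- by move=> v w e1 e2; rewrite /P !(part_depends mu gB _ e1 e2).
- by move=> v w e1 e2; rewrite (gB _ _ _ e1 e2).
have := mean_part_sqr gB Bd (fun=> erefl) gv c k.*2.
rewrite -muln2 mulnC -exprM mulnC; set a := mean _; set e := _ ^+ _ => ae.
have a0 : 0 <= a by apply: mean_ge0 => w; apply: sqr_ge0.
have := gv c; set b := mean _ => bm.
have b0 : 0 <= b by apply: mean_ge0 => w; apply: sqr_ge0.
have := sqr_ge0 (mean (g c)) => m0.
rewrite -[e]mul1r; apply: ler_pM => //; apply: le_trans bm _; lra.
Qed.

End LowDegree.

Lemma mean_prod_disjoint (R : realType) n (g : nat -> bstr n -> R)
    (B : nat -> {set 'I_n}) C :
  (forall c, depends (B c) (g c)) ->
  (forall c c', c != c' -> [disjoint B c & B c']) ->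
  mean (fun x => \prod_(c < C) g c x) = \prod_(c < C) mean (g c).
Proof.
move=> gB Bd; elim: C => [|C IH].
  rewrite big_ord0 -[RHS](mean_cst _ (card_bstr_gt0 n)).
  by apply: eq_mean => x; rewrite big_ord0.
rewrite big_ord_recr /= -IH mulrC.
rewrite (eq_mean (g := fun x => g C x * \prod_(c < C) g c x)); last first.
  by move=> x; rewrite big_ord_recr mulrC.
apply: (mean_prod_indep (mixK (indicator (B C)))) => x y.
  by apply: gB => i iB; rewrite !ffunE iB.
apply: eq_bigr => c _; apply: gB => i iB; rewrite !ffunE ifN //.
suff /disjointFr -> : [disjoint B c & B C] by [].
by apply: Bd; rewrite neq_ltn ltn_ord.
Qed.

(** * Families of monomials *)

Definition monval n (m : {set 'I_n}) (x : bstr n) := [forall i in m, x i].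

Lemma eq_monval n (m : {set 'I_n}) (x y : bstr n) :
  {in m, x =1 y} -> monval m x = monval m y.
Proof.
by move=> xy; apply: eq_forallb => i; case: (boolP (i \in m)) => //= /xy ->.
Qed.

Lemma mean_monval (R : realType) n (m : {set 'I_n}) :
  mean (fun x => (monval m x)%:R) = (2^-1) ^+ #|m| :> R.
Proof.
pose g (c : nat) (x : bstr n) : R :=
  \prod_(i in m | i == c :> nat) (x i)%:R.
pose B (c : nat) := [set i : 'I_n | i == c :> nat].
have gE x : (monval m x)%:R = \prod_(c < n) g c x.
  rewrite /g; transitivity (\prod_(i in m) (x i)%:R : R); last first.
    by rewrite (partition_big id xpredT) //=.
  case: (boolP (monval m x)) => [/forall_inP xm|].
    by rewrite big1 // => i /xm ->.
  rewrite negb_forall_in => /exists_inP[i im /negbTE xi].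
  by rewrite (bigD1 i) //= xi mul0r.
rewrite (eq_mean gE) (mean_prod_disjoint (B := B)); first last.
- move=> c c' cc'; rewrite -setI_eq0; apply/eqP/setP => i; rewrite !inE.
  by apply/negbTE; apply: contra cc' => /andP[/eqP <- /eqP <-].
- by move=> c x y xy; apply: eq_bigr => i /andP[_ ic]; rewrite xy // inE.
rewrite -prodr_const [RHS]big_mkcond /=; apply: eq_bigr => i _; rewrite /g.
case: ifP => im; last first.
  rewrite -[RHS](mean_cst _ (card_bstr_gt0 n)); apply: eq_mean => x.
  rewrite big1 // => i' /andP[i'm /eqP/val_inj ii].
  by move: i'm; rewrite ii im.
pose fl (x : bstr n) : bstr n := [ffun i' => if i' == i then ~~ x i else x i'].
have flK : involutive fl.
  move=> x; apply/ffunP => i'; rewrite !ffunE eqxx.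
  by case: eqP => // ->; rewrite negbK.
have E x : \prod_(i' in m | i' == i :> nat) ((x : bstr n) i')%:R = (x i)%:R :> R.
  rewrite (bigD1 i) ?im //= big1 ?mulr1 // => i' /andP[/andP[_ /eqP/val_inj ->]].
  by rewrite eqxx.
rewrite (eq_mean E); set a := mean _.
(* Flipping bit i preserves the uniform distribution and exchanges the values 0 and 1. *)
have : a + a = 1.
  rewrite {2}/a (mean_reindex _ (h := fl)); last by exists fl.
  rewrite -meanD -[RHS](mean_cst _ (card_bstr_gt0 n)).
  apply: eq_mean => x; rewrite ffunE eqxx.
  by case: (x i); rewrite /= ?addr0 ?add0r.
by move=> aa; lra.
Qed.

Section Family.
Variables (R : realType) (n : nat) (J : finType).
Implicit Types (P : {set J}) (m : J -> {set 'I_n}).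

(* A polynomial is given by a family of monomials, repetitions allowed, so that
   restricting variables needs no cancellation; it is studied through
   (-1) ^ p. *)
Definition fsign P m (x : bstr n) : R := \prod_(a in P) (-1) ^+ monval (m a) x.

Definition fread D P m := forall i, (#|[set a in P | i \in m a]| <= D)%N.

Lemma fsign_norm P m x : `|fsign P m x| = 1.
Proof.
rewrite /fsign normr_prod big1 // => a _.
by rewrite normrX normrN1 expr1n.
Qed.

Definition small d P m := [set a in P | #|m a| <= d]%N.

(** The two signs differ only if some monomial of degree above d has value 1, and then the double
    sum is at least 1. Charging monomials to their variables lets the read bound [n * D] stand in
    for the number of monomials. *)
Lemma fsign_small d P m x :
  `|fsign P m x - fsign (small d P m) m x| <=
  2 * \sum_i \sum_(a in P | (i \in m a) && (d < #|m a|)%N) (monval (m a) x)%:R.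
Proof.
set s := \sum_i _.
have s0 : 0 <= s by apply: sumr_ge0 => i _; apply: sumr_ge0.
case: (boolP [exists a in P, (d < #|m a|)%N && monval (m a) x]); last first.
  rewrite negb_exists_in => /forall_inP H.
  rewrite (_ : fsign P m x = fsign (small d P m) m x) ?subrr ?normr0 ?mulr_ge0 //.
  rewrite /fsign (bigID (fun a => #|m a| <= d)%N) /= [X in _ * X]big1 ?mulr1.
    by apply: eq_bigl => a; rewrite inE.
  move=> a /andP[/H]; rewrite -ltnNge negb_and => /orP[/negP //|/negbTE ->] _.
  by rewrite expr0.
move=> /exists_inP[a aP /andP[da ma]].
apply: le_trans (ler_normB _ _) _; rewrite !fsign_norm.
have /card_gt0P[i im] : (0 < #|m a|)%N by apply: leq_ltn_trans da.
suff : 1 <= s by lra.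
rewrite /s (bigD1 i) //= (bigD1 a) ?aP ?im //= ma -addrA ler_wpDr //.
by apply: addr_ge0; [apply: sumr_ge0|apply: sumr_ge0 => i' _; apply: sumr_ge0].
Qed.

Lemma fsign_small_mean (Omega : finType) (x : Omega -> bstr n) d D P m :
  fread D P m ->
  (forall s : {set 'I_n}, #|s| = d ->
     mean (fun o => (monval s (x o))%:R) <= (2^-1) ^+ d :> R) ->
  mean (fun o => `|fsign P m (x o) - fsign (small d P m) m (x o)|)
    <= 2 * (n * D)%:R * (2^-1) ^+ d.
Proof.
move=> rP xd; apply: le_trans (ler_mean (fun o => fsign_small d P m (x o))) _.
rewrite meanZ -mulrA ler_pM2l // mean_sum.
apply: le_trans (_ : \sum_(i < n) D%:R * (2^-1) ^+ d <= _); last first.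
  by rewrite sumr_const card_ord -mulrnAl natrM -mulr_natl.
apply: ler_sum => i _; rewrite mean_sum.
apply: le_trans (_ : \sum_(a in [set a in P | i \in m a]) (2^-1) ^+ d <= _); last first.
  rewrite sumr_const -[leLHS]mulr_natl ler_wpM2r ?exprn_ge0 ?invr_ge0 //.
  by rewrite ler_nat.
rewrite [leRHS]big_mkcond [leLHS]big_mkcond /=; apply: ler_sum => a _.
rewrite !inE; case: (a \in P) => //=; case: (i \in m a) => //=.
case: ltnP => [da|_]; last by rewrite exprn_ge0 ?invr_ge0.
(* Only d variables of a long monomial are kept, as many as the independence can handle; this can
   only increase the mean. *)
pose s := [set i in take d (enum (m a))].
have sm : {subset s <= m a}.
  by move=> i'; rewrite inE => /mem_take; rewrite mem_enum.
have cs : #|s| = d.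
  rewrite cardsE (card_uniqP _) ?take_uniq ?enum_uniq //.
  by rewrite size_takel // -cardE ltnW.
apply: le_trans (xd s cs); apply: ler_mean => o; rewrite ler_nat.
case: (boolP (monval (m a) _)) => // /forall_inP H.
by rewrite (_ : monval s _) //; apply/forall_inP => i' /sm /H.
Qed.

(** * Components of a sparse random set of variables *)

Section Blocks.
Variables (P : {set J}) (m : J -> {set 'I_n}) (S : bstr n).

Definition adj i i' := [&& S i, S i' & [exists a in P, (i \in m a) && (i' \in m a)]].

Lemma adj_sym : connect_sym adj.
Proof.
apply/sym_connect_sym => i i'; rewrite /adj andbCA; congr [&& _, _ & _].
by apply: eq_existsb => a; congr (_ && _); rewrite andbC.
Qed.

(** The component that a monomial touches, named by its root. A monomial without variables in S gets
    the spare label n, whose block is empty. *)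
Definition label a : nat :=
  if [pick i in m a | S i] is Some i then fingraph.root adj i else n.

Definition block (c : nat) := [set i | S i && (fingraph.root adj i == c :> nat)].

Lemma block_disjoint c c' : c != c' -> [disjoint block c & block c'].
Proof.
move=> cc'; rewrite -setI_eq0; apply/eqP/setP => i; rewrite !inE.
apply/negbTE; apply: contra cc'.
by case/andP=> /andP[_ /eqP <-] /andP[_ /eqP <-].
Qed.

Definition factor (u : bstr n) c (y : bstr n) : R :=
  \prod_(a in P | label a == c) (-1) ^+ monval (m a) (mix S y u).

Lemma fsign_factor u y :
  fsign P m (mix S y u) = \prod_(c < n.+1) factor u c y.
Proof.
pose lab a : 'I_n.+1 := inord (label a).
have labE a : lab a = label a :> nat.
  rewrite inordK // /label; case: pickP => [i _|_] //.
  by rewrite ltnS ltnW.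
rewrite /fsign (partition_big lab xpredT) //=; apply: eq_bigr => c _.
by apply: eq_bigl => a; rewrite -labE.
Qed.

(** The variables of a monomial that lie in S are pairwise adjacent, so they all belong to the
    component of the one picked by [label]. *)
Lemma factor_depends u c : depends (block c) (factor u c).
Proof.
move=> x y xy; apply: eq_bigr => a /andP[aP /eqP ac]; congr (_ ^+ _).
rewrite (@eq_monval _ _ _ (mix S y u)) // => i im; rewrite !ffunE.
case: ifP => // Si; apply: xy; rewrite inE Si /= -ac /label.
case: pickP => [i' /andP[i'm Si']|/(_ i)]; last by rewrite im Si.
apply/eqP; congr val; apply/(fingraph.rootP adj_sym)/connect1.
by rewrite /adj Si Si' /=; apply/exists_inP; exists a => //; rewrite im.
Qed.

Lemma factor_sqr u c y : factor u c y ^+ 2 = 1.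
Proof.
by rewrite /factor -prodrXl big1 // => a _; rewrite -exprM mulnC exprM sqrrN !expr1n.
Qed.

(** Otherwise s would be closed under adjacency and hence contain the whole component. *)
Lemma block_exit c (s : seq 'I_n) : {subset s <= block c} -> s != [::] ->
  (size s < #|block c|)%N ->
  exists2 i, i \in s & exists2 i', i' \in block c & (i' \notin s) && adj i i'.
Proof.
move=> sB s0 lt.
have /subsetPn[v vB vs] : ~~ (block c \subset s).
  apply: contraL lt => /subset_leq_card le; rewrite -leqNgt.
  exact: leq_trans le (card_size s).
have [i0 i0s] : exists i, i \in s.
  by case: s s0 {sB lt vs} => // i s _; exists i; rewrite mem_head.
case: (boolP [exists i in s, exists i', (i' \notin s) && adj i i']).
  move=> /exists_inP[i is_ /existsP[i' /andP[i's ii']]].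
  exists i => //; exists i'; rewrite ?i's ?ii' //.
  move: (sB _ is_); rewrite !inE => /andP[_ /eqP <-].
  have /and3P[_ -> _] := ii'; apply/eqP; congr val; apply/(fingraph.rootP adj_sym).
  by rewrite adj_sym connect1.
rewrite negb_exists_in => /forall_inP H; case/negP: vs.
have cl : closed adj (mem s).
  apply: (intro_closed adj_sym) => i i' ii' is_.
  have := H i is_; rewrite negb_exists => /forallP/(_ i').
  by rewrite ii' andbT negbK.
rewrite -(@closed_connect _ _ _ cl i0 v) //.
apply/(fingraph.rootP adj_sym); move: vB (sB _ i0s); rewrite !inE.
by move=> /andP[_ /eqP vc] /andP[_ /eqP ic]; apply: val_inj; rewrite /= ic vc.
Qed.

End Blocks.

Section Grow.
Variables (P : {set J}) (m : J -> {set 'I_n}).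

Definition nbrs i := flatten [seq enum (m a) | a <- enum [set a in P | i \in m a]].

(* The sequences of length t.+1 all of whose elements but the last are
   neighbours of a later element. *)
Fixpoint grow t : seq (seq 'I_n) :=
  if t is t'.+1 then [seq v :: s | s <- grow t', v <- flatten (map nbrs s)]
  else [seq [:: v] | v <- enum 'I_n].

Lemma size_flatten_le (T U : Type) (f : T -> seq U) (s : seq T) (k : nat) :
  (forall x, size (f x) <= k)%N -> (size (flatten (map f s)) <= size s * k)%N.
Proof.
by move=> fk; elim: s => //= x s IH; rewrite size_cat mulSn leq_add.
Qed.

Lemma size_nbrs d D i : fread D P m -> (forall a, a \in P -> #|m a| <= d)%N ->
  (size (nbrs i) <= D * d)%N.
Proof.
move=> rP md; apply: leq_trans (_ : #|[set a in P | i \in m a]| * d <= _)%N;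
  last by rewrite leq_mul2r rP orbT.
rewrite cardE /nbrs; have : all (mem P) (enum [set a in P | i \in m a]).
  by apply/allP => a; rewrite mem_enum inE => /andP[].
elim: (enum _) => //= a s IH /andP[aP sP].
by rewrite size_cat mulSn leq_add ?IH // -cardE md.
Qed.

Lemma size_in_grow t s : s \in grow t -> size s = t.+1.
Proof.
elim: t s => [|t IH] s /=; first by move=> /mapP[v _ ->].
by move=> /allpairsPdep[s' [v [/IH s't _ ->]]] /=; rewrite s't.
Qed.

(** An extension chooses an element of the sequence, which has at most l elements at that time, and
    then one of its at most K neighbours. *)
Lemma size_grow l K t : (forall i, size (nbrs i) <= K)%N -> (t <= l)%N ->
  (size (grow t) <= n * (l * K) ^ t)%N.
Proof.
move=> nK; elim: t => [|t IH] tl.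
  by rewrite /= size_map -cardE card_ord muln1.
rewrite expnSr mulnA /=; apply: leq_trans (leq_mul (IH (ltnW tl)) (leqnn _)).
apply: (@leq_trans (sumn [seq (l * K)%N | _ <- grow t])).
  rewrite size_allpairs_dep; have := @size_in_grow t.
  elim: (grow t) => //= s r IHr sz; rewrite leq_add //; last first.
    by apply: IHr => s' s'r; apply: sz; rewrite inE s'r orbT.
  apply: leq_trans (size_flatten_le s nK) _.
  by rewrite leq_mul2r sz ?mem_head // tl orbT.
by elim: (grow t) => //= s r IHr; rewrite mulSn leq_add2l.
Qed.

Lemma large_block_grow (S : bstr n) c l : (l < #|block P m S c|)%N ->
  exists2 s, s \in grow l & uniq s && all S s.
Proof.
move=> lB.
suff H t : (t <= l)%N -> exists2 s, s \in grow t & uniq s /\ {subset s <= block P m S c}.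
  have [s sg [us sB]] := H l (leqnn l); exists s; rewrite // us /=.
  by apply/allP => i /sB; rewrite inE => /andP[].
elim: t => [_|t IH tl].
  have /card_gt0P[i iB] : (0 < #|block P m S c|)%N by apply: leq_ltn_trans lB.
  exists [:: i]; first by apply/mapP; exists i; rewrite ?mem_enum.
  by split=> // i'; rewrite inE => /eqP ->.
have [s sg [us sB]] := IH (ltnW tl).
have ss := size_in_grow sg.
have [||i is_ [i' i'B /andP[i's ii']]] := block_exit sB.
- by rewrite -size_eq0 ss.
- by rewrite ss; apply: leq_ltn_trans lB.
exists (i' :: s); last first.
  split; first by rewrite /= i's.
  by move=> j; rewrite inE => /orP[/eqP ->|/sB].
apply/allpairsPdep; exists s, i'; split=> //.
apply/flattenP; exists (nbrs i); first exact: map_f.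
have /and3P[_ _ /exists_inP[a aP /andP[ia i'a]]] := ii'.
by apply/flattenP; exists (enum (m a)); rewrite ?mem_enum //;
  apply/mapP; exists a; rewrite ?mem_enum ?inE ?aP.
Qed.

(** Union bound over [grow l]: a large component contains such a sequence of [l + 1] distinct
    variables, all of them in S. *)
Lemma large_block_mean (Omega : finType) (S : Omega -> bstr n) (q : R) l K :
  0 <= q -> (forall i, size (nbrs i) <= K)%N ->
  (forall s : {set 'I_n}, #|s| = l.+1 ->
    mean (fun o => (monval s (S o))%:R) <= q ^+ l.+1) ->
  mean (fun o => ([exists c : 'I_n, (l < #|block P m (S o) c|)%N])%:R)
    <= (n * (l * K) ^ l)%:R * q ^+ l.+1.
Proof.
move=> q0 nK Sq.
apply: le_trans (_ : mean (fun o => \sum_(s <- grow l | uniq s)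
   (monval [set i in s] (S o))%:R) <= _).
  apply: ler_mean => o.
  case: (boolP [exists c, _]) => [/existsP[c /large_block_grow[s sg /andP[us sS]]]|_];
    last by apply: sumr_ge0.
  rewrite (big_rem s) //= us (_ : monval _ _); last first.
    by apply/forall_inP => i; rewrite inE => /(allP sS).
  by rewrite ler_wpDr //; apply: sumr_ge0.
rewrite mean_sum; apply: le_trans (_ : \sum_(s <- grow l) q ^+ l.+1 <= _).
  rewrite big_mkcond /= big_seq [leRHS]big_seq; apply: ler_sum => s sg.
  case: ifP => us; last by rewrite exprn_ge0.
  by apply: Sq; rewrite cardsE (card_uniqP _) // (size_in_grow sg).
rewrite big_const_seq count_predT iter_addr addr0 -[leLHS]mulr_natl.
by rewrite ler_wpM2r ?exprn_ge0 // ler_nat size_grow.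
Qed.

End Grow.

End Family.

(** * One round, and iterated rounds *)

Definition sand n (S T : bstr n) : bstr n := [ffun i => S i && T i].

Section Step.
Variables (R : realType) (n : nat) (J : finType).
Implicit Types (P : {set J}) (m : J -> {set 'I_n}).
Notation X := (bstr n).

(** The fresh input is split into its part u outside S and its part u' inside S. For fixed u, the
    mean over u' is [noisy] of f restricted to S. *)
Lemma mean_mix_sand (S T : X) x (f : X -> R) :
  mean (fun u => f (mix (sand S T) x u)) =
  mean (fun u => mean (fun u' => f (mix S (mix T x u') u))).
Proof.
rewrite -[LHS](mean_mix S) mean_exchange; apply: eq_mean => u.
apply: eq_mean => u'; congr f; apply/ffunP => i; rewrite !ffunE.
by case: (S i); case: (T i).
Qed.

Lemma small_blocks_fooled (Omega : finType) (Y : Omega -> X * X) (S u : X)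
    P m l k K :
  (0 < #|Omega|)%N -> dwise R K Y -> (2 * (k.*2.+1 * l) <= K)%N ->
  (forall c : 'I_n, #|block P m S c| <= l)%N ->
  `|mean (fun o => noisy (fun y => fsign R P m (mix S y u)) (Y o))
     - mean (fun y => fsign R P m (mix S y u))| <= n.+1%:R * (2^-1) ^+ k.
Proof.
move=> O0 hY lK Sl.
have Bl c : (#|block P m S c| <= l)%N.
  have [cn|nc] := ltnP c n; first exact: (Sl (Ordinal cn)).
  (* Roots are below n, so blocks with larger indices are empty. *)
  rewrite (_ : block _ _ _ _ = set0) ?cards0 //; apply/setP => i.
  rewrite !inE; apply/negbTE; rewrite negb_and; apply/orP; right.
  by rewrite neq_ltn (leq_trans (ltn_ord _) nc).
pose g c := noisy (factor R P m S u c).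
have gdep c : pair_depends (block P m S c) (g c).
  move=> [x T] [x' T'] /= e1 e2; apply: eq_mean => y; apply: factor_depends.
  by move=> i iB /=; rewrite !ffunE e1 // e2.
have fac1 c y : `|factor R P m S u c y| = 1.
  apply/eqP; rewrite -(@eqrXn2 _ 2) // expr1n real_normK ?num_real //.
  by rewrite factor_sqr.
have g1 c w : `|g c w| <= 1.
  apply: le_trans (mean_norm _) _.
  rewrite -[leRHS](mean_cst _ (card_bstr_gt0 n)).
  by apply: ler_mean => y; rewrite fac1.
have gv c : mean (fun w => (g c w - mean (g c)) ^+ 2) <= (1 - mean (g c) ^+ 2) / 2.
  by rewrite mean_noisy; apply: noisy_contraction => x; apply: factor_sqr.
have := dwise_fools_product n.+1 O0 hY lK g1 gdep Bl (@block_disjoint _ _ P m S) gv.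
congr (`|_ - _| <= _); first (apply: eq_mean => o).
  rewrite /noisy (eq_mean (fun y => fsign_factor R P m S u _)) /=.
  rewrite (mean_prod_disjoint (B := block P m S)
    (g := fun c y => factor R P m S u c (mix (Y o).2 (Y o).1 y))) //.
    move=> c y y' yy'; apply: factor_depends => i iB; rewrite !ffunE yy' //.
  exact: block_disjoint.
rewrite (eq_mean (fsign_factor R P m S u)).
rewrite (mean_prod_disjoint (B := block P m S)) //; last exact: block_disjoint.
  by apply: eq_bigr => c _; rewrite mean_noisy.
exact: factor_depends.
Qed.

(** The first term pays for dropping the long monomials under both distributions, the second for the
    event that S has a component of more than l variables, and the third for the product over small
    components. *)
Lemma round_fools (OmegaS Omega : finType) (S : OmegaS -> X) (Y : Omega -> X * X)
    (d l k K D : nat) (q : R) P m :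
  (0 < #|OmegaS|)%N -> (0 < #|Omega|)%N -> dwise R K Y ->
  (2 * (k.*2.+1 * l) <= K)%N -> (d <= K)%N -> 0 <= q ->
  (forall s : {set 'I_n}, #|s| = l.+1 ->
    mean (fun o => (monval s (S o))%:R) <= q ^+ l.+1) ->
  fread D P m ->
  `|mean (fun oS => mean (fun o => mean (fun u =>
       fsign R P m (mix (sand (S oS) (Y o).2) (Y o).1 u)))) - mean (fsign R P m)|
  <= 4 * (n * D)%:R * (2^-1) ^+ d + 2 * (n * (l * (D * d)) ^ l)%:R * q ^+ l.+1
     + n.+1%:R * (2^-1) ^+ k.
Proof.
move=> OS0 O0 hY lK dK q0 Sq rP.
pose f := fsign R P m; pose f' := fsign R (small d P m) m.
pose x (o : OmegaS * (Omega * X)) :=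
  mix (sand (S o.1) (Y o.2.1).2) (Y o.2.1).1 o.2.2.
have mx (g : X -> R) : mean (fun oS => mean (fun o => mean (fun u =>
    g (mix (sand (S oS) (Y o).2) (Y o).1 u)))) = mean (fun o => g (x o)).
  rewrite [RHS]mean_pair; apply: eq_mean => oS.
  by rewrite [RHS]mean_pair; apply: eq_mean.
have X0 := card_bstr_gt0 n.
have rP' : fread D (small d P m) m.
  move=> i; apply: leq_trans (rP i); apply: subset_leq_card.
  by apply/subsetP => a; rewrite !inE => /andP[/andP[-> _] ->].
(* For fixed S and u only d indices of Y are read, so Y may be taken uniform; the overwritten input
   is then uniform as well. *)
have xmon (s : {set 'I_n}) : #|s| = d ->
    mean (fun o => (monval s (x o))%:R) <= (2^-1) ^+ d :> R.
  move=> sd; rewrite -(mx (fun y => (monval s y)%:R)) -[leRHS](mean_cst _ OS0).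
  apply: ler_mean => oS.
  rewrite mean_exchange.
  rewrite (eq_mean (g := fun u => mean (fun w : X * X =>
     (monval s (mix (sand (S oS) w.2) w.1 u))%:R))); last first.
    move=> u; apply: (hY s); first by rewrite sd.
    move=> v w e1 e2; rewrite (@eq_monval _ _ _ (mix (sand (S oS) w.2) w.1 u)) //.
    by move=> i si; rewrite !ffunE e1 // e2.
  rewrite mean_exchange mean_pair mean_exchange -[leRHS](mean_cst _ X0).
  apply: ler_mean => T.
  by rewrite [leLHS](mean_mix (sand (S oS) T) (fun y => (monval s y)%:R))
    mean_monval sd.
have e1 : `|mean (fun o => f (x o)) - mean (fun o => f' (x o))|
    <= 2 * (n * D)%:R * (2^-1) ^+ d.
  rewrite -meanB; apply: le_trans (mean_norm _) _.
  exact: fsign_small_mean rP xmon.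
have e2 : `|mean f - mean f'| <= 2 * (n * D)%:R * (2^-1) ^+ d.
  rewrite -meanB; apply: le_trans (mean_norm _) _.
  apply: (fsign_small_mean (x := id)) rP _ => s sd.
  by rewrite mean_monval sd.
have e3 : `|mean (fun o => f' (x o)) - mean f'| <=
    2 * (n * (l * (D * d)) ^ l)%:R * q ^+ l.+1 + n.+1%:R * (2^-1) ^+ k.
  rewrite -(mx f') -(mean_cst (mean f') OS0) -meanB.
  apply: le_trans (mean_norm _) _.
  have md a : a \in small d P m -> (#|m a| <= d)%N by rewrite inE => /andP[].
  have := large_block_mean q0 (fun i => size_nbrs i rP' md) Sq.
  move=> lb.
  apply: le_trans (_ : mean (fun oS =>
      2 * ([exists c : 'I_n, (l < #|block (small d P m) m (S oS) c|)%N])%:R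
      + n.+1%:R * (2^-1) ^+ k) <= _); last first.
    by rewrite meanD mean_cst // lerD2r meanZ -[leRHS]mulrA ler_pM2l.
  apply: ler_mean => oS.
  have k0 : 0 <= n.+1%:R * (2^-1) ^+ k :> R by rewrite mulr_ge0 ?exprn_ge0 ?invr_ge0.
  case: (boolP [exists c, _]) => [_|].
    rewrite mulr1 ler_wpDr //; apply: le_trans (ler_normB _ _) _.
    apply: lerD; apply: le_trans (mean_norm _) _.
      rewrite -[leRHS](mean_cst _ O0); apply: ler_mean => o.
      apply: le_trans (mean_norm _) _.
      rewrite -[leRHS](mean_cst _ X0); apply: ler_mean => u.
      by rewrite fsign_norm.
    rewrite -[leRHS](mean_cst _ X0); apply: ler_mean => u.
    by rewrite fsign_norm.
  rewrite negb_exists => /forallP Sl; rewrite mulr0 add0r.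
  have Sl' (c : 'I_n) : (#|block (small d P m) m (S oS) c| <= l)%N.
    by rewrite leqNgt; apply: Sl.
  have -> : mean f' = mean (fun u => mean (fun y => f' (mix (S oS) y u))).
    by rewrite -[LHS](mean_mix (S oS)) mean_exchange.
  rewrite (eq_mean (fun o => mean_mix_sand (S oS) (Y o).2 (Y o).1 f')).
  rewrite mean_exchange -meanB; apply: le_trans (mean_norm _) _.
  rewrite -[leRHS](mean_cst _ X0); apply: ler_mean => u.
  exact: (small_blocks_fooled u O0 hY lK Sl').
rewrite mx -/f.
have -> : mean (fun o => f (x o)) - mean f =
  (mean (fun o => f (x o)) - mean (fun o => f' (x o)))
  + (mean (fun o => f' (x o)) - mean f') - (mean f - mean f') by ring.
apply: le_trans (ler_normB _ _) _.
apply: le_trans (lerD (ler_normD _ _) (lexx _)) _.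
lra.
Qed.

(** Fixing the variables of V to x kills some monomials and shortens the others to [left_over]. The
    indices are kept, so distinct monomials may acquire equal remainders. *)
Definition alive P m (V x : X) := [set a in P | [forall i in m a, V i ==> x i]].
Definition left_over m (V : X) a := [set i in m a | ~~ V i].

Lemma fsign_mix P m V x y :
  fsign R P m (mix V x y) = fsign R (alive P m V x) (left_over m V) y.
Proof.
rewrite /fsign big_mkcond [RHS]big_mkcond; apply: eq_bigr => a _; rewrite inE.
case: (a \in P) => //=; case: ifP => [/forall_inP al|/negbT].
  congr (_ ^+ nat_of_bool _); apply/forall_inP/forall_inP => H i.
    by rewrite inE => /andP[/H]; rewrite !ffunE; case: (V i).
  move=> im; rewrite ffunE; have := al i im; have := H i; rewrite inE im.
  by case: (V i) => //= /(_ isT).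
rewrite negb_forall_in => /exists_inP[i im]; rewrite negb_imply => /andP[Vi xi].
case: (boolP (monval _ _)) => // /forall_inP/(_ i im); rewrite ffunE Vi.
by rewrite (negbTE xi).
Qed.

Lemma fread_mix D P m V x : fread D P m -> fread D (alive P m V x) (left_over m V).
Proof.
move=> rP i; apply: leq_trans (rP i); apply: subset_leq_card.
by apply/subsetP => a; rewrite !inE => /andP[/andP[-> _] /andP[]].
Qed.

End Step.

Section Iterate.
Variables (R : realType) (n : nat) (J : finType) (D : nat).
Variables (Omega : finType) (V E : Omega -> bstr n) (delta rho : R).
Notation X := (bstr n).
Hypothesis Omega_gt0 : (0 < #|Omega|)%N.
Hypothesis rho_ge0 : 0 <= rho.
Hypothesis step : forall (P : {set J}) m, fread D P m ->
  `|mean (fun o => mean (fun u => fsign R P m (mix (V o) (E o) u)))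
    - mean (fsign R P m)| <= delta.
Hypothesis cover : forall i, mean (fun o => (~~ V o i)%:R) <= rho.

(** The round unfolded first is applied outermost, so its values take precedence over those of all
    other rounds. *)
Fixpoint rounds A (f : X -> R) (y : X) : R :=
  if A is A'.+1 then mean (fun o => rounds A' (fun x => f (mix (V o) (E o) x)) y)
  else f y.

Lemma eq_rounds A f g y : f =1 g -> rounds A f y = rounds A g y.
Proof.
elim: A f g => [|A IH] f g fg //=; apply: eq_mean => o.
by apply: IH => x.
Qed.

(** Hybrid argument: the outermost round changes the mean by at most delta, and for each of its
    outcomes the remaining rounds act on a restricted polynomial, which is still read-D. *)
Lemma rounds_fool A (P : {set J}) m : fread D P m ->
  `|mean (rounds A (fsign R P m)) - mean (fsign R P m)| <= A%:R * delta.
Proof.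
elim: A P m => [|A IH] P m rP; first by rewrite subrr normr0 mul0r.
rewrite /= mean_exchange.
set M := mean (fun o => mean (fun u => fsign R P m (mix (V o) (E o) u))).
have := step rP; rewrite -/M => sM.
suff sA : `|mean (fun o => mean (rounds A (fun x => fsign R P m (mix (V o) (E o) x)))) - M|
    <= A%:R * delta.
  apply: le_trans (ler_distD M _ _) _.
  by rewrite -[A.+1]addn1 natrD mulrDl mul1r lerD.
rewrite /M -meanB; apply: le_trans (mean_norm _) _.
rewrite -[leRHS](mean_cst _ Omega_gt0); apply: ler_mean => o.
have fE := fsign_mix R P m (V o) (E o).
rewrite (eq_mean fE) (eq_mean (fun y => eq_rounds A y fE)).
by apply: IH; apply: fread_mix.
Qed.

(** The starting string matters only if some variable of K is never overwritten; each round
    multiplies the expected number of survivors by at most rho. *)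
Lemma rounds_start A (K : {set 'I_n}) f y y' :
  (forall x, `|f x| <= 1) -> depends K f ->
  `|rounds A f y - rounds A f y'| <= 2 * #|K|%:R * rho ^+ A.
Proof.
elim: A K f => [|A IH] K f f1 fK /=.
  rewrite mulr1; have [/cards0_eq K0|K0] := posnP #|K|.
    by rewrite (fK y y') ?subrr ?normr0 ?mulr_ge0 // => i; rewrite K0 inE.
  apply: le_trans (ler_normB _ _) _.
  have : 1 <= #|K|%:R :> R by rewrite ler1n.
  have := f1 y; have := f1 y'; lra.
rewrite -meanB; apply: le_trans (mean_norm _) _.
apply: le_trans (_ : mean (fun o => 2 * rho ^+ A * \sum_(i in K) (~~ V o i)%:R) <= _).
  apply: ler_mean => o.
  apply: le_trans (IH [set i in K | ~~ V o i] _ _ _) _ => //.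
    move=> x x' xx'; apply: fK => i iK; rewrite !ffunE; case: ifP => // Vi.
    by apply: xx'; rewrite inE iK Vi.
  rewrite mulrAC ler_wpM2l ?mulr_ge0 ?exprn_ge0 //.
  rewrite -natr_sum ler_nat -sum1_card big_mkcond /= [leqRHS]big_mkcond /=.
  by apply: leq_sum => i _; rewrite inE; case: (i \in K); case: (V o i).
rewrite meanZ mean_sum exprS.
have -> : 2 * #|K|%:R * (rho * rho ^+ A) = 2 * rho ^+ A * (\sum_(i in K) rho).
  by rewrite sumr_const -mulr_natl; ring.
by rewrite ler_wpM2l ?mulr_ge0 ?exprn_ge0 // ler_sum.
Qed.

Lemma rounds_fool_from A (P : {set J}) m y : fread D P m ->
  `|rounds A (fsign R P m) y - mean (fsign R P m)|
    <= A%:R * delta + 2 * n%:R * rho ^+ A.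
Proof.
move=> rP.
apply: le_trans (ler_distD (mean (rounds A (fsign R P m))) _ _) _.
rewrite addrC lerD //; first exact: rounds_fool.
rewrite -(mean_cst (rounds A _ y) (card_bstr_gt0 n)) -meanB.
apply: le_trans (mean_norm _) _.
rewrite -[leRHS](mean_cst _ (card_bstr_gt0 n)); apply: ler_mean => y'.
have := @rounds_start A setT (fsign R P m) y y'; rewrite cardsT card_ord.
apply=> [x|x x' xx']; first by rewrite fsign_norm.
by congr fsign; apply/ffunP => i; apply: xx'.
Qed.

End Iterate.

(** * Bounded independence from residues *)

Local Close Scope ring_scope.

(** By Pascal's rule the next coefficient is a sum of two terms, each at least the current one. *)
Lemma expn2_central_bin m : 2 ^ m <= 'C(m.*2, m).
Proof.
elim: m => // m IH; rewrite doubleS binS expnS mul2n -addnn.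
apply: leq_add; apply: leq_trans IH _; first by rewrite binS leq_addl.
exact: leq_bin2l.
Qed.

(** By Legendre's formula the exponent is the sum over k of [2m %/ p ^ k - 2 (m %/ p ^ k)]. Each
    summand is at most 1 and vanishes once [p ^ k] exceeds [2m]. *)
Lemma logn_central_bin p m : prime p -> logn p 'C(m.*2, m) <= trunc_log p m.*2.
Proof.
move=> pp.
have p1 := prime_gt1 pp.
have E : logn p 'C(m.*2, m) + (logn p m`! + logn p m`!) = logn p (m.*2)`!.
  rewrite -lognM ?fact_gt0 // -lognM ?muln_gt0 ?fact_gt0 ?bin_gt0 //; last first.
    by rewrite -addnn leq_addr.
  by rewrite -(bin_fact (_ : m <= m.*2)) -addnn ?leq_addr // addnK.
have F : logn p m`! = \sum_(1 <= k < m.*2.+1) m %/ p ^ k.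
  (* Zero terms extend the sum to the range that occurs for the factorial of [m.*2]. *)
  rewrite logn_fact // [RHS](big_cat_nat_idem _ _ _ (n := m.+1)) //; last first.
    by rewrite ltnS -addnn leq_addr.
  rewrite [X in _ = _ + X]big1_seq ?addn0 // => k /andP[_].
  rewrite mem_index_iota => /andP[mk _]; apply: divn_small.
  by apply: leq_trans mk (ltnW (ltn_expl _ p1)).
suff : logn p (m.*2)`! <= trunc_log p m.*2 + (logn p m`! + logn p m`!).
  by rewrite -E leq_add2r.
rewrite F logn_fact // -big_split /=.
have -> : trunc_log p m.*2 =
    \sum_(1 <= k < m.*2.+1) (k <= trunc_log p m.*2).
  rewrite (big_cat_nat_idem _ _ _ (n := (trunc_log p m.*2).+1)) //=; last first.
    have [->|m0] := posnP m; first by rewrite trunc_log0.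
    by rewrite ltnS ltnW // (leq_trans (ltn_expl _ p1)) // trunc_logP // double_gt0.
  rewrite [X in _ = _ + X]big1_seq ?addn0.
    rewrite (eq_big_nat _ _ (F2 := fun=> 1)); last by move=> k /andP[_]; rewrite ltnS => ->.
    by rewrite sum_nat_const_nat subSS subn0 muln1.
  by move=> k /andP[_]; rewrite mem_index_iota => /andP[kt _]; rewrite leqNgt kt.
rewrite -big_split /=; apply: leq_sum => k _.
rewrite -{1}addnn divnD ?expn_gt0 ?prime_gt0 // addnC leq_add2r.
case: (leqP (p ^ k) (m %% p ^ k + m %% p ^ k)) => // le.
suff -> : k <= trunc_log p m.*2 by [].
have m0 : 0 < m.*2.
  rewrite double_gt0; case: m le {E F} => //; rewrite mod0n addn0 leqn0.
  by rewrite expn_eq0 => /andP[/eqP p0]; rewrite p0 in pp.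
apply: trunc_log_max => //; apply: leq_trans le _; rewrite -addnn.
by rewrite leq_add // leq_mod.
Qed.

(* If every q <= 2m divides an element of s then lcm(1..2m), hence the central
   binomial coefficient, divides the product of s. *)
Lemma prod_covering_ge m (s : seq nat) : all (leq 1) s ->
  (forall q, 0 < q -> q <= m.*2 -> has (dvdn q) s) -> 2 ^ m <= \prod_(x <- s) x.
Proof.
move=> s0 H; have N0 : 0 < \prod_(x <- s) x.
  by rewrite big_seq; apply: prodn_cond_gt0 => x /(allP s0).
apply: leq_trans (expn2_central_bin m) _; apply: dvdn_leq => //.
(* For each prime p, the exact power of p in the binomial coefficient is at most [m.*2], so it is
   one of the q. *)
apply/dvdn_partP; first by rewrite bin_gt0 -addnn leq_addr.
move=> p pC; have pp : prime p by move: pC; rewrite mem_primes => /andP[].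
rewrite p_part.
have m0 : 0 < m.*2.
  by case: m pC {H} => //; rewrite bin0.
have le : p ^ logn p 'C(m.*2, m) <= m.*2.
  apply: leq_trans (trunc_logP (prime_gt1 pp) m0).
  by rewrite leq_exp2l ?prime_gt1 // logn_central_bin.
have pos : 0 < p ^ logn p 'C(m.*2, m) by rewrite expn_gt0 prime_gt0.
have /hasP[x xs px] := H _ pos le.
by apply: dvdn_trans px _; rewrite (big_rem x) //= dvdn_mulr.
Qed.

Definition distn_nat a b := (a - b) + (b - a).

(** If no modulus works, each one up to [m.*2] divides some difference [|i' - i|]. Fewer than K
    factors, each at most n, would then have a product of at least [2 ^ m]. *)
Lemma modn_separating n K m (J : {set 'I_n}) i : n ^ K < 2 ^ m -> #|J| <= K ->
  i \in J -> exists2 q, q < m.*2 &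
    forall i', i' \in J -> i' != i -> i' %% q.+1 != i %% q.+1.
Proof.
move=> nm JK iJ.
case: (boolP [exists q : 'I_m.*2, [forall i' in J, (i' != i) ==> (i' %% q.+1 != i %% q.+1)]]).
  move=> /existsP[q /forall_inP H]; exists q => // i' i'J i'i.
  by have := H i' i'J; rewrite i'i.
rewrite negb_exists => /forallP H; exfalso.
pose s := [seq distn_nat i' i | i' : 'I_n <- enum (J :\ i)].
have s0 : all (leq 1) s.
  apply/allP => x /mapP[i']; rewrite mem_enum !inE => /andP[i'i _] ->.
  rewrite /distn_nat addn_gt0 !subn_gt0 orbC -neq_ltn.
  by apply: contra i'i => /eqP/val_inj ->.
have cov q : 0 < q -> q <= m.*2 -> has (dvdn q) s.
  case: q => // q _ qm; have := H (Ordinal qm).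
  rewrite negb_forall_in => /exists_inP[i' i'J]; rewrite negb_imply negbK /=.
  move=> /andP[i'i eq]; apply/hasP; exists (distn_nat i' i).
    by apply: map_f; rewrite mem_enum !inE i'i.
  rewrite /distn_nat; have [le|/ltnW le] := leqP i' i.
    by rewrite (eqP (_ : i' - i == 0)) ?subn_eq0 // add0n -eqn_mod_dvd // eq_sym.
  by rewrite (eqP (_ : i - i' == 0)) ?subn_eq0 // addn0 -eqn_mod_dvd.
have := prod_covering_ge s0 cov; rewrite leqNgt => /negP; apply.
apply: leq_ltn_trans nm; apply: (@leq_trans (n ^ size s)); last first.
  have n0 : 0 < n by apply: leq_ltn_trans (ltn_ord i).
  rewrite leq_pexp2l // size_map -cardE; apply: leq_trans JK.
  by apply/subset_leq_card/subD1set.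
rewrite /s; elim: (enum _) => [|i' r IH]; rewrite ?big_nil // big_cons /= expnS.
rewrite leq_mul // /distn_nat; have := ltn_ord i; have := ltn_ord i'; lia.
Qed.

Local Open Scope ring_scope.

Section Average.
Variable R : realType.

Definition avg s (f : seq bool -> R) := mean (fun z : s.-tuple bool => f z).

Lemma card_bits_gt0 s : (0 < #|{: s.-tuple bool}|)%N.
Proof. by rewrite card_tuple card_bool expn_gt0. Qed.

Lemma avg_cat a b f :
  avg (a + b) f = avg a (fun x => avg b (fun y => f (x ++ y))).
Proof.
rewrite /avg -(mean_pair (fun p : a.-tuple bool * b.-tuple bool => f (p.1 ++ p.2))).
apply: (@mean_reindex _ _ _ (fun p : a.-tuple bool * b.-tuple bool =>
  cat_tuple p.1 p.2)).
apply: inj_card_bij; last by rewrite card_prod !card_tuple expnD.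
move=> [x y] [x' y'] /(congr1 val) /= /eqP.
by rewrite eqseq_cat ?size_tuple // => /andP[/eqP/val_inj -> /eqP/val_inj ->].
Qed.

Definition flip p (z : seq bool) := mkseq (fun i => nth false z i (+) (i == p)) (size z).

Lemma nth_flip p z i : (p < size z)%N ->
  nth false (flip p z) i = nth false z i (+) (i == p).
Proof.
move=> pz; have [iz|zi] := ltnP i (size z); first by rewrite nth_mkseq.
rewrite !nth_default ?size_mkseq //; case: eqP => // ip.
by move: pz; rewrite -ip ltnNge zi.
Qed.

Lemma avg_flip p s f : avg s f = avg s (fun z => f (flip p z)).
Proof.
have sz (z : s.-tuple bool) : size (flip p z) == s by rewrite size_mkseq size_tuple.
rewrite /avg (mean_reindex _ (h := fun z => Tuple (sz z))) //.
have K : involutive (fun z => Tuple (sz z)).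
  move=> z; apply: val_inj => /=; apply: (@eq_from_nth _ false).
    by rewrite !size_mkseq.
  move=> i; rewrite !size_mkseq => iz.
  by rewrite nth_mkseq ?size_mkseq // nth_mkseq // -addbA addbb addbF.
by exists (fun z => Tuple (sz z)).
Qed.

End Average.

Section Kbit.
Variable B : nat.

(** The B * B seed bits from [off] on form a table; row q is indexed by the residues modulo [q + 1],
    all of which are below B. *)
Definition kbit (z : seq bool) off i :=
  \big[addb/false]_(q < B) nth false z (off + (q * B + i %% q.+1)).

Lemma kpos_lt (q : 'I_B) i : (q * B + i %% q.+1 < B * B)%N.
Proof.
have := ltn_ord q; have := ltn_pmod i (ltn0Sn q); nia.
Qed.

Lemma kbit_catl z z' off i : (off + B * B <= size z)%N ->
  kbit (z ++ z') off i = kbit z off i.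
Proof.
move=> le; apply: eq_bigr => q _; rewrite nth_cat.
by rewrite (leq_trans _ le) // ltn_add2l kpos_lt.
Qed.

Lemma kbit_catr z z' off i : kbit (z ++ z') (size z + off) i = kbit z' off i.
Proof.
apply: eq_bigr => q _; rewrite nth_cat -addnA ltnNge leq_addr /=.
by rewrite addKn.
Qed.

Lemma kpos_eq (q q' : 'I_B) i i' :
  (q * B + i %% q.+1 == q' * B + i' %% q'.+1)%N
    = (q == q') && (i %% q.+1 == i' %% q.+1)%N.
Proof.
apply/eqP/andP => [e|[/eqP -> /eqP ->]] //.
have lt (p : 'I_B) j : (j %% p.+1 < B)%N.
  exact: leq_trans (ltn_pmod j (ltn0Sn p)) (ltn_ord p).
have B0 : (0 < B)%N by apply: leq_ltn_trans (ltn_ord q).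
have qq : q = q'.
  apply: val_inj; have := congr1 (divn^~ B) e.
  by rewrite !divnMDl // !divn_small ?lt // !addn0.
split; first by rewrite qq.
by move: e; rewrite -qq => /addnI ->.
Qed.

Lemma kbit_flip (q : 'I_B) z i i' : (B * B <= size z)%N ->
  kbit (flip (q * B + i %% q.+1)%N z) 0 i' = kbit z 0 i' (+) (i' %% q.+1 == i %% q.+1)%N.
Proof.
move=> sz; rewrite /kbit.
under eq_bigr => q' _ do
  rewrite nth_flip ?(leq_trans (kpos_lt _ _) sz) // add0n kpos_eq.
rewrite big_split /=; congr (_ (+) _).
rewrite (bigD1 q) //= eqxx /= big1 ?addbF // => q' /negbTE ->.
by [].
Qed.

Variables (R : realType) (n : nat).

Definition kstr z : bstr n := [ffun i : 'I_n => kbit z 0 i].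

(** Induction on the size of J. The seed bit at a separating modulus flips output i and no other
    output in J, so f may be replaced by its average g over bit i, which depends on one variable
    fewer. *)
Lemma kwise (K m : nat) (J : {set 'I_n}) (f : bstr n -> R) :
  (B = m.*2)%N -> (n ^ K < 2 ^ m)%N -> (#|J| <= K)%N -> depends J f ->
  avg (B * B) (fun z => f (kstr z)) = mean f.
Proof.
move=> Bm nm; move cJ : #|J| => c; elim: c J f cJ => [|c IH] J f cJ cK fJ.
  have fc x : f x = f [ffun=> false].
    by apply: fJ => i; rewrite (cards0_eq cJ) inE.
  rewrite /avg (eq_mean (g := fun=> f [ffun=> false])) //.
  rewrite mean_cst ?card_bits_gt0 //.
  by rewrite (eq_mean fc) mean_cst ?card_bstr_gt0.
have /card_gt0P[i iJ] : (0 < #|J|)%N by rewrite cJ.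
have JK : (#|J| <= K)%N by rewrite cJ.
have [q qm qsep] := modn_separating nm JK iJ.
rewrite -Bm in qm; pose p := (Ordinal qm * B + i %% q.+1)%N.
pose fl (x : bstr n) : bstr n := [ffun i' => x i' (+) (i' == i)].
have flK : involutive fl by move=> x; apply/ffunP => i'; rewrite !ffunE -addbA addbb addbF.
pose g x := 2^-1 * (f x + f (fl x)).
have gJ : depends (J :\ i) g.
  move=> x y xy; rewrite /g; congr (_ * _).
  have [e|e] := eqVneq (x i) (y i).
    congr (_ + _); apply: fJ => i' i'J; rewrite ?ffunE;
      have [->|i'i] := eqVneq i' i; rewrite ?e // ?addbF; by rewrite ?xy // !inE i'i.
  (* Here x and y differ at i, so f at x matches f at the flip of y, and conversely. *)
  rewrite addrC; congr (_ + _); apply: fJ => i' i'J; rewrite ?ffunE;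
    have [->|i'i] := eqVneq i' i; rewrite ?addbF.
  - by case: (x i) (y i) e => -[].
  - by rewrite xy // !inE i'i.
  - by case: (x i) (y i) e => -[].
  - by rewrite xy // !inE i'i.
have cg : #|J :\ i| = c by have := cardsD1 i J; rewrite iJ cJ => -[].
have := IH _ g cg (ltnW cK) gJ.
have -> : mean g = mean f.
  rewrite /g meanZ meanD -(mean_reindex f (h := fl)); last by exists fl.
  by lra.
move=> <-; rewrite /g /avg meanZ meanD.
suff -> : mean (fun z : (B * B).-tuple bool => f (fl (kstr z))) =
          mean (fun z : (B * B).-tuple bool => f (kstr z)) by lra.
rewrite -/(avg _ (fun z => f (kstr z))) (avg_flip p); apply: eq_mean => z.
apply: fJ => i' i'J; rewrite !ffunE kbit_flip ?size_tuple //=; congr (_ (+) _).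
have [->|i'i] := eqVneq i' i; first by rewrite eqxx.
by rewrite (negbTE (qsep i' i'J i'i)).
Qed.

End Kbit.

(** * The generator *)

Definition all_kbits B z off w i :=
  all (fun b => kbit B z (off + b * (B * B)) i) (iota 0 w).

(** A round uses [w + 2] seed tables. The conjunction of the first w defines S, the next one is T,
    and the last gives the new values; the final segment of the seed takes precedence. *)
Fixpoint gen B w A z i : bool :=
  if A is A'.+1 then
    let off := (A' * (w.+2 * (B * B)))%N in
    if all_kbits B z off w.+1 i then kbit B z (off + w.+1 * (B * B)) i
    else gen B w A' z i
  else false.

Lemma all_kbits_catl B z z' off w i : (off + w * (B * B) <= size z)%N ->
  all_kbits B (z ++ z') off w i = all_kbits B z off w i.
Proof.
move=> le; apply: eq_in_all => b; rewrite mem_iota add0n => /= bw.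
by rewrite kbit_catl //; apply: leq_trans le; nia.
Qed.

Lemma all_kbits_catr B z z' off w i :
  all_kbits B (z ++ z') (size z + off) w i = all_kbits B z' off w i.
Proof. by apply: eq_all => b; rewrite -addnA kbit_catr. Qed.

Lemma gen_catl B w A z z' i : (A * (w.+2 * (B * B)) <= size z)%N ->
  gen B w A (z ++ z') i = gen B w A z i.
Proof.
elim: A => //= A IH le; rewrite IH; last by apply: leq_trans le; nia.
by rewrite all_kbits_catl ?kbit_catl //; apply: leq_trans le; nia.
Qed.

Section Gen.
Variables (R : realType) (n B w : nat).
Notation M := (B * B)%N.
Notation X := (bstr n).

Definition sstr v z : X := [ffun i : 'I_n => all_kbits B z 0 v i].
Definition estr z : X := [ffun i : 'I_n => kbit B z (w.+1 * M) i].
Definition genstr A z : X := [ffun i : 'I_n => gen B w A z i].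

Lemma sstr_cat v z z' : size z = (v * M)%N ->
  sstr v.+1 (z ++ z') = sand (sstr v z) (kstr B n z').
Proof.
move=> sz; apply/ffunP => i; rewrite !ffunE /all_kbits -addn1 iotaD all_cat /=.
rewrite -[all _ (iota 0 v)]/(all_kbits B (z ++ z') 0 v i) all_kbits_catl ?sz //.
by rewrite andbT !add0n -sz -[size z]addn0 kbit_catr.
Qed.

(** Both sides peel off the last segment of the seed first; the starting string is constantly
    false. *)
Lemma rounds_gen A (f : X -> R) :
  avg (A * (w.+2 * M)) (fun z => f (genstr A z)) =
  rounds (fun z : (w.+2 * M).-tuple bool => sstr w.+1 z)
         (fun z : (w.+2 * M).-tuple bool => estr z) A f [ffun=> false].
Proof.
elim: A f => [|A IH] f /=.
  rewrite /avg -[RHS](mean_cst _ (card_bits_gt0 0)); apply: eq_mean => z.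
  by congr f; apply/ffunP => i; rewrite !ffunE.
rewrite mulSnr avg_cat {1}/avg mean_exchange; apply: eq_mean => z2.
rewrite -IH; apply: eq_mean => z1; congr f; apply/ffunP => i.
rewrite !ffunE /= gen_catl ?size_tuple //.
have e off : (A * (w.+2 * M) + off = size z1 + off)%N by rewrite size_tuple.
have := all_kbits_catr B z1 z2 0 w.+1 i; rewrite addn0 size_tuple => ->.
by rewrite e kbit_catr.
Qed.

Section Wise.
Variables (K m : nat).
Hypotheses (Bm : (B = m.*2)%N) (nm : (n ^ K < 2 ^ m)%N).

(** The v conjuncts use disjoint parts of the seed, and each is true on all of s with probability
    [2^-|s|]. *)
Lemma mean_sstr v (s : {set 'I_n}) : (#|s| <= K)%N ->
  avg (v * M) (fun z => (monval s (sstr v z))%:R) = ((2^-1) ^+ v) ^+ #|s| :> R.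
Proof.
move=> sK; elim: v => [|v IH].
  rewrite expr0 expr1n /avg -[RHS](mean_cst _ (card_bits_gt0 (0 * M))).
  apply: eq_mean => z; rewrite (_ : monval _ _) //.
  by apply/forall_inP => i _; rewrite ffunE.
rewrite mulSnr avg_cat exprSr exprMn_comm //; last exact: mulrC.
rewrite -IH -meanZr; apply: eq_mean => z1.
rewrite -(mean_monval R s) -(kwise Bm nm sK (f := fun x => (monval s x)%:R)).
  rewrite -meanZ; apply: eq_mean => z2; rewrite sstr_cat ?size_tuple //.
  rewrite -natrM mulnb; congr (nat_of_bool _)%:R.
  apply/forall_inP/andP => [H|[/forall_inP H1 /forall_inP H2] i si].
    by split; apply/forall_inP => i /H; rewrite ffunE => /andP[].
  by rewrite ffunE H1 // H2.
by move=> x y xy; rewrite (eq_monval xy).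
Qed.

Lemma sstr_cover i : (0 < K)%N ->
  mean (fun z : (w.+2 * M).-tuple bool => (~~ sstr w.+1 z i)%:R) =
    1 - (2^-1) ^+ w.+1 :> R.
Proof.
move=> K0.
have E z : (~~ sstr w.+1 z i)%:R = 1 - (monval [set i] (sstr w.+1 z))%:R :> R.
  rewrite (_ : monval _ _ = sstr w.+1 z i); last first.
    apply/forall_inP/idP => [H|H i']; first by apply: H; rewrite inE.
    by rewrite inE => /eqP ->.
  by case: (sstr _ _ _); rewrite ?subr0 ?subrr.
rewrite -/(avg _ (fun z => (~~ sstr w.+1 z i)%:R)) mulSnr avg_cat.
rewrite [LHS](eq_mean (g := fun z1 : (w.+1 * M).-tuple bool =>
   1 - (monval [set i] (sstr w.+1 z1))%:R)); last first.
  move=> z1; rewrite -E -[RHS](mean_cst _ (card_bits_gt0 M)).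
  apply: eq_mean => z2; congr ((~~ _)%:R); rewrite !ffunE all_kbits_catl //.
  by rewrite size_tuple.
rewrite meanB mean_cst ?card_bits_gt0 //; congr (_ - _).
by rewrite [LHS]mean_sstr cards1.
Qed.

(** The components are exchanged because the seed holds T before the values, whereas [noisy] takes
    the values first. *)
Lemma dwise_kstr :
  dwise R K (fun z : M.-tuple bool * M.-tuple bool => (kstr B n z.2, kstr B n z.1)).
Proof.
move=> J f JK fJ; rewrite !mean_pair mean_exchange.
transitivity (mean (fun z2 : M.-tuple bool => mean (fun T => f (kstr B n z2, T)))).
  apply: eq_mean => z2.
  apply: (kwise Bm nm JK (f := fun T => f (kstr B n z2, T))).
  by move=> x y xy; apply: fJ.
apply: (kwise Bm nm JK (f := fun x => mean (fun T => f (x, T)))).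
by move=> x y xy; apply: eq_mean => T; apply: fJ.
Qed.

Lemma gen_step (J : finType) (P : {set J}) mn d l k D :
  (2 * (k.*2.+1 * l) <= K)%N -> (d <= K)%N -> (l < K)%N -> fread D P mn ->
  `|mean (fun z : (w.+2 * M).-tuple bool => mean (fun u =>
       fsign R P mn (mix (sstr w.+1 z) (estr z) u))) - mean (fsign R P mn)|
  <= 4 * (n * D)%:R * (2^-1) ^+ d
     + 2 * (n * (l * (D * d)) ^ l)%:R * ((2^-1) ^+ w) ^+ l.+1
     + n.+1%:R * (2^-1) ^+ k.
Proof.
move=> lK dK l1K rP.
have q0 : 0 <= (2^-1) ^+ w :> R by rewrite exprn_ge0 ?invr_ge0.
have O0 : (0 < #|{: M.-tuple bool * M.-tuple bool}|)%N.
  by rewrite card_prod muln_gt0 !card_bits_gt0.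
have Sq (s : {set 'I_n}) : #|s| = l.+1 ->
    mean (fun z : (w * M).-tuple bool => (monval s (sstr w z))%:R)
      <= ((2^-1) ^+ w) ^+ l.+1 :> R.
  by move=> sl; rewrite -/(avg _ (fun z => (monval s (sstr w z))%:R))
    mean_sstr ?sl.
have := round_fools (card_bits_gt0 (w * M)) O0 dwise_kstr lK dK q0 Sq rP.
congr (`|_ - _| <= _).
rewrite -[RHS]/(avg (w.+2 * M) (fun z => mean (fun u =>
       fsign R P mn (mix (sstr w.+1 z) (estr z) u)))).
rewrite (_ : (w.+2 * M = w * M + (M + M))%N); last by lia.
rewrite avg_cat; apply: eq_mean => zS; rewrite avg_cat mean_pair.
apply: eq_mean => zT; apply: eq_mean => zD; apply: eq_mean => u /=.
congr (fsign _ _ _ (mix _ _ _)).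
  rewrite catA; apply/ffunP => i; rewrite [RHS]ffunE all_kbits_catl; last first.
    by rewrite size_cat !size_tuple; lia.
  have := sstr_cat zT (size_tuple zS) => /ffunP/(_ i) <-.
  by rewrite ffunE.
apply/ffunP => i; rewrite !ffunE catA.
rewrite (_ : (w.+1 * M = size (zS ++ zT) + 0)%N) ?kbit_catr //.
by rewrite size_cat !size_tuple; lia.
Qed.

Lemma gen_fools (J : finType) (P : {set J}) mn A d l k D :
  (2 * (k.*2.+1 * l) <= K)%N -> (d <= K)%N -> (l < K)%N -> fread D P mn ->
  `|avg (A * (w.+2 * M)) (fun z => fsign R P mn (genstr A z)) - mean (fsign R P mn)|
  <= A%:R * (4 * (n * D)%:R * (2^-1) ^+ d
     + 2 * (n * (l * (D * d)) ^ l)%:R * ((2^-1) ^+ w) ^+ l.+1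
     + n.+1%:R * (2^-1) ^+ k) + 2 * n%:R * (1 - (2^-1) ^+ w.+1) ^+ A.
Proof.
move=> lK dK l1K rP; rewrite rounds_gen.
apply: (rounds_fool_from (card_bits_gt0 _)) => //.
- by rewrite subr_ge0 exprn_ile1 ?invr_ge0 // invf_le1 // ler1n.
- by move=> P' m' rP'; apply: gen_step.
- by move=> i; rewrite sstr_cover //; apply: leq_ltn_trans l1K.
Qed.

End Wise.
End Gen.

(** * Parameters *)

Local Close Scope ring_scope.

(* With L = 2 ^ lam, the degree bound d, the component bound l and half the number
   of factors h_c are all L ^ 2, the independence is L ^ 5, and S has density L ^ -7. *)
Definition size_param (n D k : nat) := up_log 2 n + D + k + 16.
Definition lam n D k := up_log 2 (size_param n D k).
Definition width n D k := 7 * lam n D k.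
Definition bsize n D k := 2 ^ width n D k.
(** There are B * B rounds. A variable escapes one with probability [1 - 1 / (2 B)], hence all of
    them with probability at most [2^-(B / 2)]. *)
Definition seedlen n D k :=
  (bsize n D k * bsize n D k) *
  ((width n D k).+2 * (bsize n D k * bsize n D k)).

Section SizeBounds.
Variables n D k : nat.
Let L := 2 ^ lam n D k.
Let B := bsize n D k.

Lemma size_param_le : size_param n D k <= L.
Proof. exact: up_logP. Qed.

Lemma L_ge16 : 16 <= L.
Proof. by apply: leq_trans size_param_le; rewrite leq_addl. Qed.

Lemma bsizeE : B = L ^ 7.
Proof. by rewrite /B /bsize /width mulnC expnM. Qed.

Lemma width_gt0 : 0 < width n D k.
Proof.
rewrite /width muln_gt0 /=.
by have := L_ge16; rewrite /L; case: (lam n D k).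
Qed.

Lemma bsize_double : B = (2 ^ (width n D k).-1).*2.
Proof. by rewrite -mul2n -expnS prednK // width_gt0. Qed.

Lemma half_bsize_gt : L ^ 6 < 2 ^ (width n D k).-1.
Proof.
rewrite -ltn_double -bsize_double bsizeE (expnS L 6) -mul2n.
have L2 : 2 < L by apply: leq_trans L_ge16.
by rewrite ltn_pmul2r // expn_gt0 (ltnW (ltnW L2)).
Qed.

(** As [n <= 2 ^ L], the left side is at most [2 ^ (L ^ 6)], while half of [B = L ^ 7] exceeds
    [L ^ 6]. *)
Lemma wise_param : n ^ (L ^ 5) < 2 ^ (2 ^ (width n D k).-1).
Proof.
apply: (@leq_ltn_trans (2 ^ (L ^ 6))); last by rewrite ltn_exp2l // half_bsize_gt.
apply: (@leq_trans ((2 ^ up_log 2 n) ^ (L ^ 5))).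
  by rewrite leq_exp2r ?expn_gt0 ?(leq_trans _ L_ge16) // up_logP.
rewrite -expnM leq_exp2l // expnS leq_mul2r; apply/orP; right.
by apply: leq_trans size_param_le; rewrite /size_param -!addnA leq_addr.
Qed.

Lemma wise_ge1 : 2 * ((L ^ 2).*2.+1 * L ^ 2) <= L ^ 5.
Proof.
have -> : L ^ 5 = L * (L ^ 2 * L ^ 2) by rewrite -expnD -expnS.
have := L_ge16; have : 0 < L ^ 2 by rewrite expn_gt0 (leq_trans _ L_ge16).
move: (L ^ 2) => M M0 L16.
apply: (@leq_trans (16 * (M * M))); last by rewrite leq_mul2r L16 orbT.
nia.
Qed.

Lemma wise_ge2 : L ^ 2 < L ^ 5.
Proof. by rewrite ltn_exp2l // (leq_trans _ L_ge16). Qed.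

(** Subcriticality: a growth step multiplies the number of sequences by at most
    [L ^ 2 * (D * L ^ 2)] and their probability by [L ^ -7], together by at most 1/2. *)
Lemma percolation_param : 2 * (L ^ 2 * (D * L ^ 2)) <= 2 ^ width n D k.
Proof.
rewrite -[2 ^ _]/B bsizeE.
have -> : L ^ 7 = L * L * L * (L ^ 2 * L ^ 2) by rewrite -expnD -!mulnA -!expnS.
have DL : D <= L.
  by apply: leq_trans size_param_le; rewrite /size_param; lia.
have := L_ge16; move: (L ^ 2) => M L16.
have -> : 2 * (M * (D * M)) = 2 * D * (M * M) by nia.
rewrite leq_mul2r; apply/orP; right; nia.
Qed.

End SizeBounds.

Local Open Scope ring_scope.

(** * The total error *)

Section Errors.
Variable R : realType.

(** Bernoulli's inequality gives [(1 + x) ^ N >= 2], and [(1 - x) ^ N * (1 + x) ^ N <= 1]. *)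
Lemma exp1B_le (x : R) N : 0 <= x <= 1 -> N%:R * x = 1 -> (1 - x) ^+ N <= 2^-1.
Proof.
move=> /andP[x0 x1] Nx.
have bern : 1 + N%:R * x <= (1 + x) ^+ N.
  elim: N {Nx} => [|N IH]; first by rewrite mul0r addr0.
  rewrite exprS -natr1; have : 0 <= N%:R :> R by [].
  by nra.
have le1 : (1 - x) ^+ N * (1 + x) ^+ N <= 1.
  by rewrite -exprMn exprn_ile1 //; nra.
have p0 : 0 <= (1 - x) ^+ N by rewrite exprn_ge0 // subr_ge0.
rewrite Nx in bern; nra.
Qed.

Lemma error_bound n D k (e : R) (L := (2 ^ lam n D k)%N) (B := bsize n D k) :
  (0 < n)%N -> (2^-1) ^+ k <= e ->
  (B * B)%N%:R * (4 * (n * D)%:R * (2^-1) ^+ (L ^ 2)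
     + 2 * (n * (L ^ 2 * (D * L ^ 2)) ^ (L ^ 2))%:R
         * ((2^-1) ^+ width n D k) ^+ (L ^ 2).+1
     + n.+1%:R * (2^-1) ^+ (L ^ 2))
    + 2 * n%:R * (1 - (2^-1) ^+ (width n D k).+1) ^+ (B * B) <= e :> R.
Proof.
move=> n0 ke; apply: le_trans ke.
set w := width n D k; set h := (2^-1 : R).
have h0 : 0 <= h by rewrite invr_ge0.
have hp j : 0 <= h ^+ j by rewrite exprn_ge0.
have h1 : h <= 1 by rewrite invf_le1 // ler1n.
have L16 : (16 <= L)%N := L_ge16 n D k.
pose E := h ^+ (L ^ 2).
have per : (n * (L ^ 2 * (D * L ^ 2)) ^ (L ^ 2))%:R * (h ^+ w) ^+ (L ^ 2).+1
    <= n%:R * E.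
  rewrite natrM -mulrA ler_wpM2l // exprSr mulrA natrX -exprMn.
  set b : R := _%:R * h ^+ w.
  have b0 : 0 <= b by rewrite mulr_ge0 ?hp.
  have bh : b <= h.
    rewrite /b /h exprVn ler_pdivrMr ?exprn_gt0 // mulrC ler_pdivlMr // mulrC.
    by rewrite -natrM -natrX ler_nat percolation_param.
  apply: le_trans (_ : b ^+ (L ^ 2) * 1 <= _).
    by rewrite ler_wpM2l ?exprn_ge0 // exprn_ile1.
  by rewrite mulr1 lerXn2r // nnegrE.
have cov : (1 - h ^+ w.+1) ^+ (B * B) <= E.
  have -> : (B * B = (2 * B) * 2 ^ w.-1)%N.
    by rewrite {2}/B bsize_double -/w -muln2; ring.
  rewrite exprM.
  have BE : (2 * B)%N%:R * h ^+ w.+1 = 1.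
    rewrite /B /bsize -expnS natrX -exprMn (_ : 2%:R * h = 1); first by rewrite expr1n.
    by rewrite /h; field.
  have x01 : 0 <= h ^+ w.+1 <= 1 by rewrite hp exprn_ile1.
  have := exp1B_le x01 BE; set b := _ ^+ _ => bh.
  have b0 : 0 <= b by rewrite exprn_ge0 // subr_ge0; case/andP: x01.
  apply: le_trans (_ : h ^+ (2 ^ w.-1) <= _); first by rewrite lerXn2r // nnegrE.
  rewrite /E ler_wiXn2l //; apply: leq_trans (ltnW (half_bsize_gt n D k)).
  by rewrite leq_exp2l // (leq_trans _ L16).
have E0 : 0 <= E := hp _.
(* Every error is a multiple of E: [5 * n + 1] collects 2 n from large components, n + 1 from the
   blocks and 2 n from uncovered variables. In the exponent, B * B costs at most [14 * L] and
   everything else at most [2 * L], while [16 * L <= L ^ 2]. *)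
have nat_bound : ((B * B) * (4 * (n * D) + 5 * n + 1) * 2 ^ k <= 2 ^ (L ^ 2))%N.
  apply: (@leq_trans (2 ^ (14 * L) * 2 ^ (3 + up_log 2 n + D) * 2 ^ k)); last first.
    rewrite -!expnD leq_exp2l //.
    apply: (@leq_trans (16 * L)); last by rewrite -mulnn leq_mul2r L16 orbT.
    have := size_param_le n D k; rewrite /size_param -/L; lia.
  rewrite leq_mul2r; apply/orP; right; apply: leq_mul.
    rewrite /B /bsize -expnD leq_exp2l // /width.
    have : (lam n D k < L)%N by apply: ltn_expl.
    lia.
  rewrite !expnD; have := up_logP n (isT : 1 < 2)%N; have := ltn_expl D (isT : 1 < 2)%N.
  move: (2 ^ up_log 2 n)%N (2 ^ D)%N => n' D' DD nn.
  apply: (@leq_trans (2 ^ 3 * n * D.+1)); last by rewrite leq_mul // leq_mul2l nn orbT.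
  by rewrite (_ : 2 ^ 3 = 8)%N //; nia.
apply: le_trans (_ : ((B * B) * (4 * (n * D) + 5 * n + 1))%N%:R * E <= _).
  rewrite [((B * B) * _)%N%:R]natrM -[(_ + 5 * n + 1)%N]addnA natrD [(4 * (n * D))%N%:R]natrM.
  have B1 : 1 <= (B * B)%N%:R :> R by rewrite ler1n muln_gt0 expn_gt0.
  rewrite natrD [(5 * n)%N%:R]natrM -[n.+1]addn1 natrD.
  have nE : 0 <= n%:R * E by rewrite mulr_ge0.
  move: B1; set a := (B * B)%N%:R; set nD := (n * D)%N%:R => a1.
  have c1 : 2 * n%:R * (1 - h ^+ w.+1) ^+ (B * B) <= 2 * (n%:R * E).
    by rewrite -mulrA ler_pM2l // ler_wpM2l.
  have c2 : 2 * (n%:R * E) <= a * (2 * (n%:R * E)).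
    by rewrite ler_peMl // mulr_ge0.
  have c3 : a * (4 * nD * E + 2 * (n * (L ^ 2 * (D * L ^ 2)) ^ (L ^ 2))%:R
      * (h ^+ w) ^+ (L ^ 2).+1 + (n%:R + 1%:R) * E) <=
      a * (4 * nD * E + 2 * (n%:R * E) + (n%:R + 1%:R) * E).
    rewrite ler_wpM2l ?(le_trans ler01) // lerD2r lerD2l -mulrA.
    by rewrite ler_pM2l.
  apply: le_trans (lerD c3 (le_trans c1 c2)) _.
  rewrite le_eqVlt; apply/orP; left; apply/eqP; ring.
rewrite /E /h !exprVn ler_pdivrMr ?exprn_gt0 // mulrC ler_pdivlMr ?exprn_gt0 //.
by rewrite -!natrX -natrM ler_nat.
Qed.

End Errors.

(** * Fooling and seed length *)

Section Fooling.
Variable R : realType.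

Definition bits_of n (x : bstr n) : bits n := [tuple x i | i < n].

Lemma bits_of_bij n : bijective (@bits_of n).
Proof.
exists (fun z : bits n => [ffun i => tnth z i]) => z.
  by apply/ffunP => i; rewrite ffunE tnth_mktuple.
by apply: eq_from_tnth => i; rewrite tnth_mktuple ffunE.
Qed.

Lemma probE s (A : pred (bits s)) :
  prob R A = (1 - mean (fun z => (-1) ^+ A z)) / 2.
Proof.
have -> : mean (fun z => (-1) ^+ A z) = mean (fun z => 1 - 2 * (A z)%:R) :> R.
  by apply: eq_mean => z; case: (A z); rewrite /= ?mulr0 ?mulr1; ring.
rewrite meanB mean_cst ?card_bits_gt0 // meanZ /prob.
have -> : mean (fun z : bits s => (A z)%:R) = #|A|%:R / 2 ^+ s :> R.
  rewrite /mean card_tuple card_bool natrX; congr (_ / _).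
  by rewrite -natr_sum -sum1_card [in RHS]big_mkcond.
by set t := _ / 2 ^+ s; field.
Qed.

Lemma F2_sign_add (u v : 'F_2) :
  (-1) ^+ (u + v == 1) = (-1) ^+ (u == 1) * (-1) ^+ (v == 1) :> R.
Proof.
rewrite -signr_addb; congr (_ ^+ nat_of_bool _).
by case: u v => [[|[|u]] //= hu] [[|[|v]] //= hv].
Qed.

(** The polynomial becomes the family indexed by its own monomials, with [id] as the map. *)
Lemma f2eval_fsign n (p : f2poly n) (x : bstr n) :
  (-1) ^+ (f2eval p (bits_of x) == 1) = fsign R p id x.
Proof.
have F2_sign0 : (-1) ^+ ((0 : 'F_2) == 1) = 1 :> R by rewrite expr0.
rewrite /f2eval (big_morph (fun v : 'F_2 => (-1) ^+ (v == 1)) F2_sign_add F2_sign0).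
apply: eq_bigr => m _; congr (_ ^+ nat_of_bool _).
case: (boolP (monval m x)) => [/forall_inP xm|].
  by rewrite big1 ?eqxx // => i /xm; rewrite tnth_mktuple => ->.
rewrite negb_forall_in => /exists_inP[i im /negbTE xi].
by rewrite (bigD1 i) //= tnth_mktuple xi mul0r.
Qed.

Definition prng n D (e : R) (z : bits (seedlen n D (precision e))) : bits n :=
  let k := precision e in let B := bsize n D k in
  [tuple gen B (width n D k) (B * B) z i | i < n].

Lemma log2_inv_gt0 (e : R) : 0 < e < 1 -> 0 < log2 e^-1.
Proof.
move=> /andP[e0 e1]; rewrite /log2 divr_gt0 ?ln_gt0 ?ltr1n //.
by rewrite invf_gt1.
Qed.

Lemma precision_ceil (e : R) : 0 < e < 1 ->
  (precision e)%:R = (Num.ceil (log2 e^-1))%:~R :> R.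
Proof.
move=> e01; rewrite /precision natr_absz ger0_norm //.
by rewrite ltW // ceil_gt0 log2_inv_gt0.
Qed.

Lemma precision_le (e : R) : 0 < e < 1 -> (2^-1) ^+ precision e <= e.
Proof.
move=> e01; have /andP[e0 e1] := e01.
have := ceil_ge (log2 e^-1); rewrite -precision_ceil // /log2.
rewrite ler_pdivrMr ?ln_gt0 ?ltr1n // mulr_natl -lnXn // ler_ln ?posrE ?invr_gt0 //.
  by move=> H; rewrite exprVn invf_ple ?posrE ?exprn_gt0.
by rewrite exprn_gt0.
Qed.

Lemma precision_ge (e : R) : 0 < e < 1 -> (precision e)%:R <= log2 e^-1 + 1.
Proof.
move=> e01; rewrite precision_ceil //.
have /andP[] := ceil_itv (log2 e^-1); rewrite intrB; lra.
Qed.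

Lemma prng_fools n D (e : R) : (0 < n)%N -> 0 < e < 1 ->
  fools e (@prng n D e) (@read_f2polys n D).
Proof.
move=> n0 e01 f [p rp fp]; rewrite !probE.
set k := precision e.
have rp' : fread D p id by move=> i; apply: rp.
have fE x : (-1) ^+ f (bits_of x) = fsign R p id x.
  by rewrite fp f2eval_fsign.
have -> : mean (fun x => (-1) ^+ f x) = mean (fsign R p id).
  by rewrite (mean_reindex _ (bits_of_bij n)); apply: eq_mean => x; apply: fE.
have -> : mean (fun z => (-1) ^+ f (@prng n D e z)) =
   avg (seedlen n D k) (fun z =>
     fsign R p id (genstr n (bsize n D k) (width n D k) (bsize n D k * bsize n D k) z)).
  apply: eq_mean => z; rewrite -fE; congr (_ ^+ nat_of_bool (f _)).
  by apply: eq_from_tnth => i; rewrite !tnth_mktuple ffunE.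
have := gen_fools R (width n D k) (bsize_double n D k) (wise_param n D k)
  (bsize n D k * bsize n D k) (wise_ge1 n D k) (ltnW (wise_ge2 n D k)) (wise_ge2 n D k) rp'.
move=> /le_trans/(_ (error_bound D n0 (precision_le e01))).
rewrite -/(seedlen n D k).
set a := avg _ _; set b := mean _ => ab.
have -> : (1 - a) / 2 - (1 - b) / 2 = - ((a - b) / 2) by field.
rewrite normrN normrM [`|2^-1|]gtr0_norm ?invr_gt0 //.
have := normr_ge0 (a - b); lra.
Qed.

Lemma poly_bound (a b m : nat) : exists C : nat, forall x : R, 1 <= x ->
  a%:R * (b%:R * x) ^+ m <= C%:R * x ^+ C.
Proof.
exists (a * b ^ m + m)%N => x x1.
rewrite exprMn mulrA -natrX -natrM.
apply: ler_pM => //; first by rewrite exprn_ge0 // (le_trans ler01).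
  by rewrite ler_nat leq_addr.
by rewrite ler_weXn2l // leq_addl.
Qed.

(** As [w + 2 <= B], the length is at most [B ^ 5 = L ^ 35]; rounding up to a power of 2 at most
    doubles L. *)
Lemma seedlen_le n D k : (seedlen n D k <= (2 * size_param n D k) ^ 35)%N.
Proof.
have wB : ((width n D k).+2 <= bsize n D k)%N.
  rewrite /bsize; have : (1 < width n D k)%N.
    by have := L_ge16 n D k; rewrite /width; case: (lam n D k) => // l; lia.
  elim: (width n D k) => // v IH; case: v IH => [|[|v]] // IH _.
  by rewrite expnS; have := IH isT; lia.
have LL : (2 ^ lam n D k <= 2 * size_param n D k)%N.
  have tg : (1 < size_param n D k)%N by rewrite /size_param; lia.
  have := up_log_gtn (isT : 1 < 2)%N tg; rewrite -/(lam n D k).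
  have : (0 < lam n D k)%N by have := width_gt0 n D k; rewrite muln_gt0.
  by case: (lam n D k) => // l _ /=; rewrite expnS => H; rewrite leq_mul2l ltnW.
apply: (@leq_trans (bsize n D k ^ 5)).
  by rewrite /seedlen !expnS expn0 muln1 -mulnA !leq_mul2l leq_mul2r wB !orbT.
by rewrite bsizeE -expnM leq_exp2r.
Qed.

Lemma up_log_le n : (0 < n)%N -> (up_log 2 n)%:R <= 1 + log2 n%:R :> R.
Proof.
move=> n0; have [n1|n1] := leqP n 1.
  have -> : n = 1%N by lia.
  by rewrite up_log1 /log2 ln1 mul0r addr0.
have := up_log_gtn (isT : 1 < 2)%N n1.
have : (0 < up_log 2 n)%N by rewrite up_log_gt0.
case: (up_log 2 n) => // t _ /= H; rewrite -natr1 addrC lerD2l.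
rewrite /log2 ler_pdivlMr ?ln_gt0 ?ltr1n // mulr_natl -lnXn //.
by rewrite ler_ln ?posrE ?exprn_gt0 ?ltr0n // -natrX ler_nat ltnW.
Qed.

Lemma seedlen_bound : exists C : nat, forall (n D : nat) (e : R),
  (0 < n)%N -> 0 < e < 1 -> (seedlen n D (precision e))%:R
    <= C%:R * (1 + D%:R + log2 n%:R + log2 e^-1) ^+ C :> R.
Proof.
(* [size_param] is at most 18 plus D and the two logarithms: 16, and 1 for each rounding. Doubling
   gives 36. *)
have [C HC] := poly_bound 1 36 35; exists C => n D e n0 e01.
have ln0 : 0 <= log2 n%:R :> R.
  by rewrite /log2 divr_ge0 // ln_ge0 // ?ler1n.
have le0 := log2_inv_gt0 e01; have D0 : 0 <= D%:R :> R by [].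
apply: le_trans (HC _ _); last by lra.
rewrite mul1r; have := seedlen_le n D (precision e).
rewrite -(ler_nat R) natrX => /le_trans; apply.
apply: lerXn2r; rewrite ?nnegrE //; first by rewrite mulr_ge0 //; lra.
rewrite /size_param natrM !natrD.
have := up_log_le n0; have := precision_ge e01.
by lra.
Qed.

End Fooling.

(** * The machine program *)

Local Close Scope ring_scope.

Definition rep st (vs : seq nat) (m : nat -> nat) :=
  (forall r, reg st r = nth 0 vs r) /\ (forall a, cell st a = m a).

(** A Hoare triple for total correctness within time T. Registers form an explicit list, so that
    straight-line code is executed by computation. *)
Definition run c vs m T vs' m' := forall st, rep st vs m ->
  exists t st', [/\ exec c st t st', t <= T & rep st' vs' m'].

Lemma run_weaken c vs m T vs' m' T0 vs0 m0 :
  run c vs m T0 vs0 m0 -> vs0 = vs' -> m0 =1 m' -> T0 <= T -> run c vs m T vs' m'.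
Proof.
move=> h <- mE le st /h[t [st' [ex tT [r1 r2]]]].
by exists t, st'; split=> //; [apply: leq_trans le|split=> // a; rewrite r2].
Qed.

Lemma run_ext c vs m m0 T vs' m' :
  m0 =1 m -> run c vs m T vs' m' -> run c vs m0 T vs' m'.
Proof. by move=> mE h st [r1 r2]; apply: h; split=> // a; rewrite r2. Qed.

Lemma run_set_reg c r v vs m :
  (forall st, rep st vs m -> exec c st 1 (set_reg st r v)) ->
  run c vs m 1 (set_nth 0 vs r v) m.
Proof.
move=> h st rp; exists 1, (set_reg st r v); split=> //; first exact: h.
have [r1 r2] := rp; split=> // r'; rewrite nth_set_nth /= /upd.
by rewrite -r1.
Qed.

Lemma run_const r v vs m : run (Const r v) vs m 1 (set_nth 0 vs r v) m.
Proof. by apply: run_set_reg => st _; apply: exec_const. Qed.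

Lemma run_add r a b vs m :
  run (Add r a b) vs m 1 (set_nth 0 vs r (nth 0 vs a + nth 0 vs b)) m.
Proof.
by apply: run_set_reg => st [r1 _]; rewrite -!r1; apply: exec_add.
Qed.

Lemma run_sub r a b vs m :
  run (Sub r a b) vs m 1 (set_nth 0 vs r (nth 0 vs a - nth 0 vs b)) m.
Proof.
by apply: run_set_reg => st [r1 _]; rewrite -!r1; apply: exec_sub.
Qed.

Lemma run_fetch r a vs m :
  run (Fetch r a) vs m 1 (set_nth 0 vs r (m (nth 0 vs a))) m.
Proof.
by apply: run_set_reg => st [r1 r2]; rewrite -r1 -r2; apply: exec_fetch.
Qed.

Lemma run_store a r vs m :
  run (Store a r) vs m 1 vs (upd m (nth 0 vs a) (nth 0 vs r)).
Proof.
move=> st [r1 r2]; exists 1, (set_cell st (reg st a) (reg st r)).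
by split=> //; [apply: exec_store|split=> // b; rewrite /= /upd r2 !r1].
Qed.

Lemma run_seq c1 c2 vs m T1 vs1 m1 T2 vs2 m2 :
  run c1 vs m T1 vs1 m1 -> run c2 vs1 m1 T2 vs2 m2 ->
  run (Seq c1 c2) vs m (T1 + T2) vs2 m2.
Proof.
move=> h1 h2 st /h1[t1 [st1 [e1 le1 /h2[t2 [st2 [e2 le2 rp]]]]]].
by exists (t1 + t2), st2; split=> //; [apply: exec_seq e1 e2|apply: leq_add].
Qed.

Lemma run_if r c1 c2 vs m T vs1 m1 vs2 m2 :
  run c1 vs m T vs1 m1 -> run c2 vs m T vs2 m2 ->
  run (If r c1 c2) vs m T.+1 (if nth 0 vs r != 0 then vs1 else vs2)
    (if nth 0 vs r != 0 then m1 else m2).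
Proof.
move=> h1 h2 st rp; have [r1 _] := rp; rewrite -r1; case: ifPn => [nz|].
  have [t [st' [e le rp']]] := h1 st rp.
  by exists t.+1, st'; split=> //; apply: exec_if_true.
rewrite negbK => /eqP z; have [t [st' [e le rp']]] := h2 st rp.
by exists t.+1, st'; split=> //; apply: exec_if_false.
Qed.

Lemma run_while r c (F : nat -> seq nat) (M : nat -> nat -> nat) T N :
  (forall j, j < N -> nth 0 (F j) r != 0) ->
  (forall j, j < N -> run c (F j) (M j) T (F j.+1) (M j.+1)) ->
  nth 0 (F N) r = 0 ->
  run (While r c) (F 0) (M 0) (N * T.+1).+1 (F N) (M N).
Proof.
elim: N F M => [|N IH] F M nz body done.
  move=> st rp; exists 1, st; split=> //; apply: exec_while_done.
  by have [r1 _] := rp; rewrite r1.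
move=> st rp; have [t1 [st1 [e1 le1 rp1]]] := body 0 isT st rp.
have [t2 [st2 [e2 le2 rp2]]] := IH (F \o succn) (M \o succn)
  (fun j => nz j.+1) (fun j => body j.+1) done st1 rp1.
exists (t1 + t2).+1, st2; split=> //; last by rewrite mulSn; lia.
by apply: exec_while_step e1 e2; have [-> _] := rp; apply: nz.
Qed.

Notation "c1 ;; c2" := (Seq c1 c2) (at level 60, right associativity).

Ltac run_atom := first
  [ apply: run_const | apply: run_add | apply: run_sub
  | apply: run_fetch | apply: run_store ].
Ltac run_step := eapply run_seq; [run_atom | cbn [set_nth nth]].
Ltac run_steps := repeat run_step; try (run_atom; cbn [set_nth nth]).

(* Registers: 4 the constant 1; 5 size_param; 8 L; 9 B; 10 w + 1; 11 the index i of
   the output bit; 12 the position in the seed; 13 the output bit; 14 the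
   conjunction defining V; 15 the remaining blocks of V; 16 the parity; 17 B - q;
   18 q; 19 i mod q; 20 addresses and loop tests; 21 the bit read; 22 s minus
   register 12; 23 n - i; 6 and 7 scratch.  Scratch registers are reset to 0, so that
   the final values of all registers can be specified.  As the seed occupies the
   cells of the output, output bit i first goes to cell s + i. *)
Definition nop := Const 7 0.

(** Reduction by repeated subtraction. For current remainder r, register 20 holds the truncated
    [r + 1 - q], nonzero exactly when [q <= r]. *)
Definition mod_loop := While 20 (Sub 19 19 18 ;; Add 20 19 4 ;; Sub 20 20 18).

(** Adding register 7, which is 0, copies a register. Register 18 is increased first, so the modulus
    is one more than the row number; adding B to register 12 passes to the next row. *)
Definition kbit_body :=
  Add 18 18 4 ;; Add 19 11 7 ;; Add 20 19 4 ;; Sub 20 20 18 ;; mod_loop ;;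
  Add 20 12 19 ;; Fetch 21 20 ;; If 21 (Sub 16 4 16) nop ;;
  Add 12 12 9 ;; Sub 17 17 4 ;; Const 19 0 ;; Const 20 0 ;; Const 21 0.

Definition kbit_prog := Const 16 0 ;; Add 17 9 7 ;; While 17 kbit_body ;; Const 18 0.

Definition round_prog :=
  Const 14 1 ;; Add 15 10 7 ;;
  While 15 (kbit_prog ;; If 16 nop (Const 14 0) ;; Sub 15 15 4 ;; Const 16 0) ;;
  kbit_prog ;; If 14 (Add 13 16 7) nop ;; Const 14 0 ;; Const 16 0.

(** Rounds run in the order of the seed, later ones overwriting the output bit, which agrees with
    the precedence in [gen]. *)
Definition bit_prog :=
  Sub 22 3 12 ;; While 22 (round_prog ;; Sub 22 3 12) ;;
  Add 20 3 11 ;; Store 20 13 ;; Const 20 0 ;; Const 12 0 ;; Const 13 0.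

Definition bits_prog :=
  Sub 23 0 11 ;; While 23 (bit_prog ;; Add 11 11 4 ;; Sub 23 0 11) ;; Const 11 0.

Definition copy_prog :=
  Sub 23 0 11 ;;
  While 23 (Add 20 3 11 ;; Fetch 21 20 ;; Store 11 21 ;; Add 11 11 4 ;;
            Sub 23 0 11 ;; Const 20 0 ;; Const 21 0).

Definition log_prog :=
  Const 4 1 ;; Const 6 1 ;; Sub 7 0 6 ;;
  While 7 (Add 6 6 6 ;; Add 5 5 4 ;; Sub 7 0 6) ;;
  Add 5 5 1 ;; Add 5 5 2 ;; Const 6 16 ;; Add 5 5 6 ;; Const 6 0.

(** Seven doublings of B for each doubling of L maintain [B = L ^ 7] without multiplication. *)
Definition param_prog :=
  Const 8 1 ;; Const 9 1 ;; Sub 7 5 8 ;;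
  While 7 (Add 8 8 8 ;; Add 9 9 9 ;; Add 9 9 9 ;; Add 9 9 9 ;; Add 9 9 9 ;;
           Add 9 9 9 ;; Add 9 9 9 ;; Add 9 9 9 ;;
           Const 7 7 ;; Add 10 10 7 ;; Sub 7 5 8) ;;
  Add 10 10 4.

Definition prng_prog := log_prog ;; param_prog ;; bits_prog ;; copy_prog.

Section Registers.
Variables n D k s tg L B w : nat.

Definition regs i p out fl c x r q rm u v rs ri : seq nat :=
  [:: n; D; k; s; 1; tg; 0; 0; L; B; w.+1; i; p; out; fl; c; x; r; q; rm; u; v; rs; ri].

Lemma run_mod i p out fl c x r q v rs ri m : 0 < q ->
  run mod_loop (regs i p out fl c x r q i (i + 1 - q) v rs ri) m (4 * i).+1
      (regs i p out fl c x r q (i %% q) 0 v rs ri) m.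
Proof.
move=> q0.
have := @run_while 20 (Sub 19 19 18 ;; Add 20 19 4 ;; Sub 20 20 18)
  (fun j => regs i p out fl c x r q (i - j * q) (i - j * q + 1 - q) v rs ri)
  (fun=> m) 3 (i %/ q).
have div := divn_eq i q; have md := ltn_pmod i q0.
have E : i - i %/ q * q = i %% q by rewrite {1}div addKn.
have le j : j < i %/ q -> j.+1 * q <= i.
  by move=> jq; apply: leq_trans (leq_trunc_div i q); rewrite leq_mul2r jq orbT.
rewrite mul0n subn0 E (_ : i %% q + 1 - q = 0); last by lia.
move=> h; apply: run_weaken (h _ _ _) _ _ _ => //.
- by move=> j /le; rewrite /= mulSn; lia.
- move=> j /le jq; apply: run_weaken; first by rewrite /regs; run_steps.
  + by rewrite /regs mulSn [q + _]addnC subnDA.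
  + by [].
  + by [].
- by have := leq_div i q; lia.
Qed.

Variable z : seq bool.

Definition seeded (m : nat -> nat) :=
  forall a, a < s -> m a = nat_of_bool (nth false z a).

Lemma run_kbit i p out fl c x rs ri m : seeded m -> p + B * B <= s ->
  run kbit_prog (regs i p out fl c x 0 0 0 0 0 rs ri) m (B * (4 * i + 16) + 4)
      (regs i (p + B * B) out fl c (kbit B z p i) 0 0 0 0 0 rs ri) m.
Proof.
move=> sm ps.
pose X j := \big[addb/false]_(q < j) nth false z (p + (q * B + i %% q.+1)).
pose F j := regs i (p + j * B) out fl c (X j) (B - j) j 0 0 0 rs ri.
have body j : j < B -> run kbit_body (F j) m (4 * i + 15) (F j.+1) m.
  move=> jB; have pos : p + j * B + i %% j.+1 < s.
    by have := ltn_pmod i (ltn0Sn j); nia.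
  apply: run_weaken; first rewrite /F /regs /kbit_body.
  - do 4 run_step; rewrite addn0 addn1.
    eapply run_seq; [exact: run_mod|rewrite /regs].
    do 2 run_step; rewrite sm //.
    apply: (@run_seq _ _ _ _ _ (regs i (p + j * B) out fl c (X j.+1) (B - j) j.+1
      (i %% j.+1) (p + j * B + i %% j.+1)
      (nth false z (p + j * B + i %% j.+1)) rs ri) m).
      apply: run_weaken; first by apply: run_if; run_atom.
      + rewrite /= /X big_ord_recr /= addnA.
        by case: (nth false z _); case: (\big[_/_]_(_ < _) _).
      + by move=> a; case: ifP.
      + exact: leqnn.
    by rewrite /regs; run_steps.
  - by rewrite /F /regs subn1 -subnS -addnA -mulSnr.
  - by [].
  - by lia.
apply: run_weaken; first rewrite /kbit_prog /regs.
- run_step; run_step; rewrite addn0.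
  eapply run_seq.
    have := @run_while 17 kbit_body F (fun=> m) _ B _ body _.
    rewrite /F /X big_ord0 mul0n addn0 subn0 subnn; apply => //.
    by move=> j jB; rewrite /= subn_eq0 -ltnNge.
  by rewrite /regs; run_steps.
- by rewrite /regs /=.
- by [].
- by rewrite (_ : (4 * i + 15).+1 = 4 * i + 16); lia.
Qed.

Lemma all_kbitsS p v i :
  all_kbits B z p v.+1 i = all_kbits B z p v i && kbit B z (p + v * (B * B)) i.
Proof. by rewrite /all_kbits -addn1 iotaD all_cat /= andbT. Qed.

Let K i := B * (4 * i + 16) + 4.

Lemma run_round i p out rs ri m : seeded m -> p + w.+2 * (B * B) <= s ->
  run round_prog (regs i p out 0 0 0 0 0 0 0 0 rs ri) m (w.+2 * (K i + 5) + 8)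
    (regs i (p + w.+2 * (B * B))
       (if all_kbits B z p w.+1 i then nat_of_bool (kbit B z (p + w.+1 * (B * B)) i)
        else out) 0 0 0 0 0 0 0 0 rs ri) m.
Proof.
move=> sm ps.
pose F j := regs i (p + j * (B * B)) out (all_kbits B z p j i) (w.+1 - j) 0
  0 0 0 0 0 rs ri.
set body := kbit_prog ;; If 16 nop (Const 14 0) ;; Sub 15 15 4 ;; Const 16 0.
have hb j : j < w.+1 -> run body (F j) m (K i + 4) (F j.+1) m.
  move=> jw; apply: run_weaken; first rewrite /body.
  - eapply run_seq; first by apply: run_kbit => //; nia.
    apply: (@run_seq _ _ _ _ _ (regs i (p + j * (B * B) + B * B) out
      (all_kbits B z p j.+1 i) (w.+1 - j) (kbit B z (p + j * (B * B)) i)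
      0 0 0 0 0 rs ri) m).
      apply: run_weaken; first by apply: run_if; run_atom.
      + rewrite /= all_kbitsS.
        by case: (kbit _ _ _ _); case: (all_kbits _ _ _ _ _).
      + by move=> a; case: ifP.
      + exact: leqnn.
    by rewrite /regs; run_steps.
  - by rewrite /F /regs subn1 -subnS -addnA -mulSnr.
  - by [].
  - by rewrite /K; lia.
apply: run_weaken; first rewrite /round_prog /regs.
- run_step; run_step; rewrite addn0.
  eapply run_seq.
    have := @run_while 15 body F (fun=> m) _ w.+1 _ hb _.
    rewrite /F mul0n addn0 subn0 subnn; apply => //.
    by move=> j jB; rewrite /= subn_eq0 -ltnNge.
  eapply run_seq; first by apply: run_kbit => //; nia.
  apply: (@run_seq _ _ _ _ _ (regs i (p + w.+1 * (B * B) + B * B)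
    (if all_kbits B z p w.+1 i then nat_of_bool (kbit B z (p + w.+1 * (B * B)) i)
     else out) (all_kbits B z p w.+1 i) 0 (kbit B z (p + w.+1 * (B * B)) i)
    0 0 0 0 0 rs ri) m).
    apply: run_weaken; first by apply: run_if; run_atom.
    + by rewrite /=; case: (all_kbits _ _ _ _ _); rewrite ?addn0.
    + by move=> a; case: ifP.
    + exact: leqnn.
  by rewrite /regs; run_steps.
- by rewrite /regs -addnA -mulSnr.
- by [].
- by rewrite -/(K i) (_ : (K i + 4).+1 = K i + 5); lia.
Qed.

Variable A : nat.

(** The memory once j output bits are stored behind the seed; beyond them the default of [nth]
    accounts for the initial zeros. *)
Definition out_mem j a : nat :=
  if (s <= a) && (a < s + j) then nat_of_bool (gen B w A z (a - s))
  else nat_of_bool (nth false z a).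

(** Copying in increasing order is safe even if the regions overlap: when cell [s + i] is read, only
    cells below i have been overwritten. *)
Lemma run_copy : exists2 m',
  run copy_prog (regs 0 0 0 0 0 0 0 0 0 0 0 0 0) (out_mem n) (n * 8 + 3)
     (regs n 0 0 0 0 0 0 0 0 0 0 0 0) m' &
  forall i, i < n -> m' i = nat_of_bool (gen B w A z i).
Proof.
pose M j a := if a < j then nat_of_bool (gen B w A z a) else out_mem n a.
exists (M n); last by move=> i ni; rewrite /M ni.
pose F i := regs i 0 0 0 0 0 0 0 0 0 0 0 (n - i).
set body := Add 20 3 11 ;; Fetch 21 20 ;; Store 11 21 ;; Add 11 11 4 ;;
            Sub 23 0 11 ;; Const 20 0 ;; Const 21 0.
have hb i : i < n -> run body (F i) (M i) 7 (F i.+1) (M i.+1).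
  move=> ni; apply: run_weaken; first by rewrite /body /F /regs; run_steps.
  - by rewrite /F /regs addn1.
  - move=> a; rewrite /upd; case: eqP => [->|ne].
      rewrite /M ltnSn ltnNge leq_addl /= /out_mem leq_addr ltn_add2l ni.
      by rewrite addKn.
    rewrite /M; congr (if _ then _ else _); lia.
  - by [].
apply: run_weaken; first rewrite /copy_prog /regs.
- run_step.
  have := @run_while 23 body F M _ n _ hb _.
  rewrite /F subn0 subnn; apply => //.
  by move=> i ni; rewrite /= subn_eq0 -ltnNge.
- by [].
- by [].
- by lia.
Qed.

Hypotheses (B_gt0 : 0 < B) (sE : s = A * (w.+2 * (B * B))).

Lemma run_bit i ri m : seeded m ->
  run bit_prog (regs i 0 0 0 0 0 0 0 0 0 0 0 ri) m
    (A * (w.+2 * (K i + 5) + 10) + 7)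
    (regs i 0 0 0 0 0 0 0 0 0 0 0 ri) (upd m (s + i) (gen B w A z i)).
Proof.
move=> sm; pose RS := w.+2 * (B * B); have sE' : s = A * RS := sE.
have RS0 : 0 < RS by rewrite !muln_gt0 B_gt0.
pose F a := regs i (a * RS) (gen B w a z i) 0 0 0 0 0 0 0 0 (s - a * RS) ri.
have hb a : a < A ->
    run (round_prog ;; Sub 22 3 12) (F a) m (w.+2 * (K i + 5) + 9) (F a.+1) m.
  move=> aA; apply: run_weaken.
  - eapply run_seq; first by apply: run_round; rewrite // -/RS -mulSnr sE' leq_mul2r aA orbT.
    by rewrite /regs; run_steps.
  - rewrite /F /regs -/RS -mulSnr /=.
    by case: (all_kbits _ _ _ _ _).
  - by [].
  - by lia.
apply: run_weaken; first rewrite /bit_prog /regs.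
- run_step; eapply run_seq.
    have := @run_while 22 (round_prog ;; Sub 22 3 12) F (fun=> m) _ A _ hb _.
    rewrite /F mul0n; apply.
      by move=> a aA; rewrite /= subn_eq0 -ltnNge sE' ltn_mul2r RS0.
    by rewrite /= sE' subnn.
  by rewrite /regs; run_steps.
- by rewrite /regs sE' subnn.
- by [].
- by rewrite (_ : (w.+2 * (K i + 5) + 9).+1 = w.+2 * (K i + 5) + 10); lia.
Qed.

Let TB := A * (w.+2 * (K n + 5) + 10) + 10.

Lemma run_bits :
  run bits_prog (regs 0 0 0 0 0 0 0 0 0 0 0 0 0) (out_mem 0)
    (n * TB + 3) (regs 0 0 0 0 0 0 0 0 0 0 0 0 0) (out_mem n).
Proof.
pose F i := regs i 0 0 0 0 0 0 0 0 0 0 0 (n - i).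
set body := bit_prog ;; Add 11 11 4 ;; Sub 23 0 11.
have hb i : i < n -> run body (F i) (out_mem i) TB.-1 (F i.+1) (out_mem i.+1).
  move=> ni; apply: run_weaken; first rewrite /body.
  - eapply run_seq; first apply: run_bit.
      by move=> a al; rewrite /out_mem leqNgt al.
    by rewrite /regs; run_steps.
  - by rewrite /F /regs addn1.
  - move=> a; rewrite /upd /out_mem; case: eqP => [->|ne].
      by rewrite leq_addr ltn_add2l ltnSn addKn.
    congr (if _ then _ else _); lia.
  - have : K i <= K n by rewrite /K leq_add2r leq_mul2l; lia.
    rewrite /TB addnS /= => Ki.
    have : A * (w.+2 * (K i + 5) + 10) <= A * (w.+2 * (K n + 5) + 10).
      by rewrite leq_mul2l leq_add2r leq_mul2l leq_add2r Ki !orbT.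
    lia.
apply: run_weaken; first rewrite /bits_prog /regs.
- run_step; eapply run_seq.
    have := @run_while 23 body F out_mem _ n _ hb _.
    rewrite /F subn0 subnn; apply => //.
    by move=> i ni; rewrite /= subn_eq0 -ltnNge.
  by rewrite /regs; run_steps.
- by [].
- by [].
- by rewrite prednK /TB ?addnS //; lia.
Qed.

End Registers.

(** * Computing the parameters *)

Section Init.
Variables (n D k s : nat) (m : nat -> nat).

Definition iregs one tg P tmp L B w : seq nat :=
  [:: n; D; k; s; one; tg; P; tmp; L; B; w; 0; 0; 0; 0; 0; 0; 0; 0; 0; 0; 0; 0; 0].

Lemma up_log_lt j a : j < up_log 2 a -> 2 ^ j < a.
Proof. by rewrite !ltnNge; apply: contra => /(@up_log_min 2 _ _ isT). Qed.

Lemma run_log : run log_prog (iregs 0 0 0 0 0 0 0) m (4 * n + 9)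
  (iregs 1 (size_param n D k) 0 0 0 0 0) m.
Proof.
pose F j := iregs 1 j (2 ^ j) (n - 2 ^ j) 0 0 0.
set body := Add 6 6 6 ;; Add 5 5 4 ;; Sub 7 0 6.
have hb j : j < up_log 2 n -> run body (F j) m 3 (F j.+1) m.
  move=> _; apply: run_weaken; first by rewrite /body /F /iregs; run_steps.
  - by rewrite /F /iregs addn1 expnS mul2n addnn.
  - by [].
  - by [].
have done : n - 2 ^ up_log 2 n = 0 by apply/eqP; rewrite subn_eq0 up_logP.
apply: run_weaken; first rewrite /log_prog /iregs.
- run_step; run_step; run_step; eapply run_seq.
    have := @run_while 7 body F (fun=> m) _ (up_log 2 n) _ hb _.
    rewrite /F expn0 done; apply => //.
    by move=> j /up_log_lt jn; rewrite /= subn_eq0 -ltnNge.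
  by rewrite /iregs; run_steps.
- by rewrite /iregs /size_param.
- by [].
- have : up_log 2 n <= n by apply: up_log_min => //; apply/ltnW/ltn_expl.
  lia.
Qed.

Lemma run_param : run param_prog (iregs 1 (size_param n D k) 0 0 0 0 0) m
  (12 * lam n D k + 5)
  (iregs 1 (size_param n D k) 0 0 (2 ^ lam n D k) (bsize n D k) (width n D k).+1) m.
Proof.
pose tg := size_param n D k.
pose F j := iregs 1 tg 0 (tg - 2 ^ j) (2 ^ j) (2 ^ (7 * j)) (7 * j).
set body := Add 8 8 8 ;; Add 9 9 9 ;; Add 9 9 9 ;; Add 9 9 9 ;; Add 9 9 9 ;;
           Add 9 9 9 ;; Add 9 9 9 ;; Add 9 9 9 ;;
           Const 7 7 ;; Add 10 10 7 ;; Sub 7 5 8.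
have hb j : j < lam n D k -> run body (F j) m 11 (F j.+1) m.
  have E : 2 ^ (7 * j.+1) = (2 ^ (7 * j)).*2.*2.*2.*2.*2.*2.*2.
    by rewrite mulnS expnD (_ : 2 ^ 7 = 128) //; lia.
  move=> _; apply: run_weaken; first by rewrite /body /F /iregs; run_steps.
  - by rewrite /F /iregs E expnS mul2n mulnS !addnn [_ + 7]addnC.
  - by [].
  - by [].
have done : tg - 2 ^ lam n D k = 0 by apply/eqP; rewrite subn_eq0 up_logP.
apply: run_weaken; first rewrite /param_prog /iregs.
- run_step; run_step; run_step; eapply run_seq.
    have := @run_while 7 body F (fun=> m) _ (lam n D k) _ hb _.
    rewrite /F expn0 done; apply => //.
    by move=> j /up_log_lt jn; rewrite /= subn_eq0 -ltnNge.
  by rewrite /iregs; run_steps.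
- by rewrite /iregs addn1.
- by [].
- lia.
Qed.

End Init.

Lemma nat_poly_bound (a b : nat) : exists C, forall x T, 0 < x ->
  T <= a * x ^ b -> T <= C * x ^ C.
Proof.
exists (a + b) => x T x0 /leq_trans; apply.
by apply: leq_mul; rewrite ?leq_addr // leq_pexp2l // leq_addl.
Qed.

(** All quantities are at most [n + s]. The five factors come from the output bits, the rounds, the
    tables of a round, the rows of a table and the reduction of an index below n. *)
Lemma time_bound n s A B w lm :
  0 < n -> 0 < s -> A <= s -> B <= s -> w.+2 <= s -> lm <= s ->
  (4 * n + 9) + ((12 * lm + 5) +
    ((n * (A * (w.+2 * (B * (4 * n + 16) + 4 + 5) + 10) + 10) + 3) + (n * 8 + 3)))
  <= 100 * (n + s) ^ 5.
Proof.
move=> n0 s0 As Bs ws ls; set x := n + s.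
have [x2 nx sx] : [/\ 1 < x, n <= x & s <= x] by rewrite /x; split; lia.
have xE b : x ^ b.+1 = x * x ^ b by rewrite expnS.
have x1 b : 0 < x ^ b by rewrite expn_gt0; lia.
have bnd (a y c b : nat) : a <= x -> y <= c * x ^ b -> a * y <= c * x ^ b.+1.
  by move=> ax yc; rewrite xE mulnCA leq_mul.
have h1 : B * (4 * n + 16) + 4 + 5 <= 29 * x ^ 2.
  have : B * (4 * n + 16) <= 20 * x ^ 2 by apply: bnd; rewrite ?expn1; lia.
  by have := x1 2; lia.
have h2 : w.+2 * (B * (4 * n + 16) + 4 + 5) + 10 <= 39 * x ^ 3.
  have := bnd _ _ _ _ (leq_trans ws sx) h1; have := x1 3; lia.
have h3 : A * (w.+2 * (B * (4 * n + 16) + 4 + 5) + 10) + 10 <= 49 * x ^ 4.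
  have := bnd _ _ _ _ (leq_trans As sx) h2; have := x1 4; lia.
have h4 := bnd _ _ _ _ nx h3.
have h5 : x <= x ^ 5 by rewrite xE leq_pmulr.
have := leq_trans ls sx; lia.
Qed.

Lemma prng_explicit (R : realType) : explicit (@prng R).
Proof.
have [C HC] := nat_poly_bound 100 5.
exists prng_prog, C => n D e z n0 _.
set k := precision e; set s := seedlen n D k.
set B := bsize n D k; set w := width n D k; set A := B * B.
have B0 : 0 < B by rewrite expn_gt0.
have sE : s = A * (w.+2 * (B * B)) by [].
have [m' hcopy hout] := run_copy n D k s (size_param n D k) (2 ^ lam n D k) B w z A.
have hbits := @run_bits n D k s (size_param n D k) (2 ^ lam n D k) B w z A B0 sE.
pose m0 a := nat_of_bool (nth false z a).
have mE : m0 =1 out_mem s B w z A 0.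
  move=> a; rewrite /out_mem addn0; case: ifP => //; lia.
have hrun := run_seq (@run_log n D k s m0) (run_seq (@run_param n D k s m0)
  (run_seq (run_ext mE hbits) hcopy)).
have rp : rep (input n D k z) (iregs n D k s 0 0 0 0 0 0 0) m0.
  (* The input lists four registers and [iregs] twenty-four; both default to 0 beyond. *)
  by split=> // r; rewrite /iregs /=; do 24?[case: r => [|r] //=]; rewrite !nth_nil.
have [t [st [ex le [_ cs]]]] := hrun _ rp.
exists t, st; split=> //; last first.
  by move=> i; rewrite cs hout // tnth_mktuple.
apply: HC; first by rewrite addn_gt0 n0.
have w2B : w.+2 <= s.
  by rewrite sE mulnCA leq_pmulr // !muln_gt0 B0.
apply: leq_trans le _; apply: time_bound => //.
- exact: leq_trans w2B.
- by rewrite sE leq_pmulr // !muln_gt0 B0.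
- by rewrite sE -!mulnA leq_pmulr // !muln_gt0 B0.
- by apply: leq_trans w2B; rewrite /w /width; lia.
Qed.

Local Open Scope ring_scope.

Theorem theorem1p14 (R : realType) :
  exists (s : nat -> nat -> R -> nat)
         (G : forall (n D : nat) (e : R), bits (s n D e) -> bits n),
    [/\ explicit G,
        forall (n D : nat) (e : R), (0 < n)%N -> 0 < e < 1 ->
          fools e (G n D e) (@read_f2polys n D)
      & exists C : nat, forall (n D : nat) (e : R), (0 < n)%N -> 0 < e < 1 ->
          (s n D e)%:R <= C%:R * (1 + D%:R + log2 n%:R + log2 e^-1) ^+ C].
Proof.
exists (fun n D e => seedlen n D (precision e)), (@prng R); split.
- exact: prng_explicit.
- exact: prng_fools.
- exact: seedlen_bound.
Qed.
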